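(* Let $F:M\times[0,T)\to(N,g)$ be a smooth solution of the mean curvature flow. Then the mean curvature satisfies the following evolution equations: $$\nabla_{\frac{d}{dt}}H^\alpha=\Delta H^\alpha-g^{ij}C^k_{ij}F^\alpha_k+R^\alpha{}_{\delta\gamma\epsilon}F^\epsilon_iF^{\delta i}H^\gamma+2\langle A_{kl},\overrightarrow H\rangle A^{\alpha kl},$$ where $C^k_{ij}=\frac{d}{dt}\Gamma^k_{ij}$, and $$\nabla_{\frac{d}{dt}}|\overrightarrow H|^2=\Delta|\overrightarrow H|^2-2|\nabla\overrightarrow H|^2+4\langle A^{ij},\overrightarrow H\rangle\langle A_{ij},\overrightarrow H\rangle+2R_{\alpha\beta\gamma\delta}H^\alpha F^\beta_iH^\gamma F^{\delta i}$$ $$=\Delta|\overrightarrow H|^2-2|\nabla^\perp\overrightarrow H|^2+2\langle A^{ij},\overrightarrow H\rangle\langle A_{ij},\overrightarrow H\rangle+2R_{\alpha\beta\gamma\delta}H^\alpha F^\beta_iH^\gamma F^{\delta i}.$$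
   Context: $M$ is a smooth oriented closed manifold of dimension $m$, $(N,g)$ is a smooth Riemannian manifold of dimension $n$. A smooth solution of the mean curvature flow is a smooth map $F:M\times[0,T)\to N$ such that each $F_t=F(\cdot,t)$ is an immersion and $\frac{dF}{dt}(p,t)=\overrightarrow H(p,t)$, where $\overrightarrow H(\cdot,t)$ is the mean curvature vector of $F_t$. Local coordinates are $(x^i)_{i=1,\dots,m}$ on $M$ and $(y^\alpha)_{\alpha=1,\dots,n}$ on $N$; repeated indices are summed; indices are raised and lowered with $g_{ij}$, $g_{\alpha\beta}$ and their inverses. $F^\alpha_i=\partial F^\alpha/\partial x^i$, $F^{\alpha i}=g^{ij}F^\alpha_j$, $g_{ij}=g_{\alpha\beta}F^\alpha_iF^\beta_j$ is the induced metric; $\Gamma^k_{ij}$ and $\Gamma^\alpha_{\beta\gamma}$ are the Christoffel symbols of $(M,F_t^*g)$ and $(N,g)$. The second fundamental tensor $A=\nabla DF$ has components $$A^\alpha_{ij}=\frac{\partial^2F^\alpha}{\partial x^i\partial x^j}-\Gamma^k_{ij}F^\alpha_k+\Gamma^\alpha_{\beta\gamma}F^\beta_iF^\gamma_j,\qquad A_{ij}=A^\alpha_{ij}\frac{\partial}{\partial y^\alpha},$$ and $\overrightarrow H=H^\alpha\frac{\partial}{\partial y^\alpha}$ with $H^\alpha=g^{ij}A^\alpha_{ij}$. $\nabla$ denotes the full connection on bundles built from $F^*TN$, $TM$, $T^*M$ (pull-back of the Levi-Civita connection of $N$ on $F^*TN$, and Levi-Civita connection of $F_t^*g$); thus $\nabla_jH^\alpha=\frac{\partial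 H^\alpha}{\partial x^j}+\Gamma^\alpha_{\beta\gamma}F^\beta_jH^\gamma$ and $\nabla_i\nabla_jH^\alpha=\frac{\partial}{\partial x^i}(\nabla_jH^\alpha)-\Gamma^k_{ij}\nabla_kH^\alpha+\Gamma^\alpha_{\beta\gamma}F^\beta_i\nabla_jH^\gamma$. $\Delta=g^{ij}\nabla_i\nabla_j$ is the corresponding (rough) Laplacian. $\nabla^\perp$ is the connection on the normal bundle, $\nabla^\perp_i\overrightarrow H=(\nabla_i\overrightarrow H)^\perp$. Norms are taken with respect to $g$ and $F_t^*g$. The time derivative is the covariant derivative along $\frac{d}{dt}$ in the pull-back of $TN$ by $F:M\times[0,T)\to N$: $\nabla_{\frac{d}{dt}}H^\alpha=\frac{d}{dt}H^\alpha+\Gamma^\alpha_{\beta\gamma}H^\beta H^\gamma$; on functions it is $\frac{d}{dt}$. Curvature convention: $R^N(X,Y)Z=\nabla_X\nabla_YZ-\nabla_Y\nabla_XZ-\nabla_{[X,Y]}Z$, $R_{\alpha\beta\gamma\delta}=\langle\frac{\partial}{\partial y^\alpha},R^N(\frac{\partial}{\partial y^\gamma},\frac{\partial}{\partial y^\delta})\frac{\partial}{\partial y^\beta}\rangle$ and $R^\alpha{}_{\beta\gamma\delta}=g^{\alpha\epsilon}R_{\epsilon\beta\gamma\delta}$. *)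

(* Defs.v *)
From HB Require Import structures.
From mathcomp Require Import all_boot all_order all_algebra.
From mathcomp Require Import boolp classical_sets functions cardinality reals.
From mathcomp Require Import ereal topology normedtype derive.

Set Implicit Arguments.
Unset Strict Implicit.
Unset Printing Implicit Defensive.

Import Order.TTheory GRing.Theory Num.Theory.
Import numFieldNormedType.Exports.

Local Open Scope classical_set_scope.
Local Open Scope ring_scope.

(* For an open U and finite-dimensional V this is the usual class C^k: f is
   C^(k+1) iff it is differentiable with C^k directional derivatives. *)
Fixpoint Ck (R : realType) (V W : normedModType R) (k : nat) (U : set V)
    (f : V -> W) : Prop :=
  match k with
  | 0 => forall x, U x -> {for x, continuous f}
  | k'.+1 => (forall x, U x -> differentiable f x) /\
             (forall v, Ck k' U (fun x => 'D_v f x))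
  end.

Definition smooth_on (R : realType) (V W : normedModType R) (U : set V)
    (f : V -> W) : Prop := forall k, Ck k U f.

(* [cmap] and [cinv] are only meaningful on [cdom] and on its image. *)
Record chart (R : realType) (m : nat) (X : topologicalType) := Chart {
  cdom : set X;
  cmap : X -> 'rV[R]_m;
  cinv : 'rV[R]_m -> X;
  cdom_open : open cdom;
  cimg_open : open (cmap @` cdom);
  cmapK : forall p, cdom p -> cinv (cmap p) = p;
  cmap_continuous : forall p, cdom p -> {for p, continuous cmap};
  cinv_continuous : forall x, (cmap @` cdom) x -> {for x, continuous cinv} }.

Definition cimg (R : realType) (m : nat) (X : topologicalType)
    (c : chart R m X) : set 'rV[R]_m := cmap c @` cdom c.

Definition transition (R : realType) (m : nat) (X : topologicalType)
    (c c' : chart R m X) (x : 'rV[R]_m) : 'rV[R]_m := cmap c' (cinv c x).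

Definition overlap (R : realType) (m : nat) (X : topologicalType)
    (c c' : chart R m X) : set 'rV[R]_m := cmap c @` (cdom c `&` cdom c').

Definition compatible (R : realType) (m : nat) (X : topologicalType)
    (c c' : chart R m X) : Prop :=
  smooth_on (overlap c c') (transition c c') /\
  smooth_on (overlap c' c) (transition c' c).

(* The atlas is maximal, so that its charts are all the local coordinates. *)
Record smooth_manifold (R : realType) (m : nat) := SmoothManifold {
  carrier :> topologicalType;
  carrier_hausdorff : hausdorff_space carrier;
  carrier_second_countable : @second_countable carrier;
  atlas : set (chart R m carrier);
  atlas_cover : forall p, exists2 c, atlas c & cdom c p;
  atlas_compatible : forall c c', atlas c -> atlas c' -> compatible c c';
  atlas_maximal : forall c, (forall c', atlas c' -> compatible c c') -> atlas c }.

Record orientation (R : realType) (m : nat) (M : smooth_manifold R m) :=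
  Orientation {
  oatlas : set (chart R m M);
  oatlas_sub : oatlas `<=` @atlas R m M;
  oatlas_cover : forall p : M, exists2 c, oatlas c & cdom c p;
  oatlas_pos : forall c c' x, oatlas c -> oatlas c' -> overlap c c' x ->
    0 < \det ('J (transition c c') x) }.

(* A metric is given by its component matrices g_(alpha beta) in every chart,
   subject to the transformation law of covariant 2-tensors; entry (i, a) of
   the library's Jacobian 'J f x is the i-th partial derivative of f^a. *)
Record riemannian_metric (R : realType) (n : nat) (N : smooth_manifold R n) :=
  RiemannianMetric {
  gcomp : chart R n N -> 'rV[R]_n -> 'M[R]_n;
  gcomp_smooth : forall d, atlas d -> smooth_on (cimg d) (gcomp d);
  gcomp_sym : forall d y, atlas d -> cimg d y -> (gcomp d y)^T = gcomp d y;
  gcomp_pos : forall d y (v : 'rV[R]_n), atlas d -> cimg d y -> v != 0 ->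
    0 < (v *m gcomp d y *m v^T) 0 0;
  gcomp_transform : forall d d' y, atlas d -> atlas d' -> overlap d d' y ->
    gcomp d y = 'J (transition d d') y *m gcomp d' (transition d d' y)
                *m ('J (transition d d') y)^T }.

Section Coordinates.
Context {R : realType}.

Definition pder k (i : 'I_k) (phi : 'rV[R]_k -> R) (x : 'rV[R]_k) : R :=
  'D_(delta_mx 0 i) (phi : 'rV[R]_k -> R^o) x.

Definition inner k (G : 'M[R]_k) (u v : 'I_k -> R) : R :=
  \sum_a \sum_b G a b * u a * v b.

(* christoffel g x k i j is Gamma^k_(ij) at x. *)
Definition christoffel k0 (g : 'rV[R]_k0 -> 'M[R]_k0) (x : 'rV[R]_k0)
    (k i j : 'I_k0) : R :=
  2^-1 * \sum_l invmx (g x) k l *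
    (pder i (fun z => g z j l) x + pder j (fun z => g z i l) x
     - pder l (fun z => g z i j) x).

Section Curvature.
Context {n : nat} (h : 'rV[R]_n -> 'M[R]_n).

Definition vfield := 'rV[R]_n -> 'I_n -> R.

Definition levi_civita (X Y : vfield) : vfield := fun y a =>
  \sum_c X y c * (pder c (fun z => Y z a) y
                  + \sum_b christoffel h y a c b * Y y b).

Definition lie_bracket (X Y : vfield) : vfield := fun y a =>
  \sum_c (X y c * pder c (fun z => Y z a) y - Y y c * pder c (fun z => X z a) y).

Definition riemann (X Y Z : vfield) : vfield := fun y a =>
  levi_civita X (levi_civita Y Z) y a - levi_civita Y (levi_civita X Z) y a
  - levi_civita (lie_bracket X Y) Z y a.

Definition coord_field (c : 'I_n) : vfield := fun _ a => (a == c)%:R.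

(* R_(abcd) = < d_a , R(d_c, d_d) d_b > *)
Definition Rlow (y : 'rV[R]_n) (a b c d : 'I_n) : R :=
  inner (h y) (coord_field a y)
    (riemann (coord_field c) (coord_field d) (coord_field b) y).

(* R^a_(bcd) *)
Definition Rup (y : 'rV[R]_n) (a b c d : 'I_n) : R :=
  \sum_e invmx (h y) a e * Rlow y e b c d.

End Curvature.

Definition time_interval (T : \bar R) : set R :=
  [set t | 0 <= t /\ (t%:E < T)%E].

(* Derivative relative to [0, T): two-sided for t > 0, right derivative at 0. *)
Definition dtime (T : \bar R) (phi : R -> R) (t : R) : R :=
  lim ((s - t)^-1 * (phi s - phi t)
       @[s --> within (time_interval T) t^']).

Section Immersion.
(* h : metric of the target in a chart; f t : coordinate expression of F_t. *)
Context {m n : nat} (h : 'rV[R]_n -> 'M[R]_n) (f : R -> 'rV[R]_m -> 'rV[R]_n).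

(* F^a_i *)
Definition dF (t : R) (x : 'rV[R]_m) (i : 'I_m) (a : 'I_n) : R :=
  pder i (fun z => f t z 0 a) x.

(* g_(ij) *)
Definition indg (t : R) (x : 'rV[R]_m) : 'M[R]_m :=
  \matrix_(i, j) inner (h (f t x)) (dF t x i) (dF t x j).

(* g^(ij) *)
Definition ginv (t : R) (x : 'rV[R]_m) : 'M[R]_m := invmx (indg t x).

(* F^(a i) *)
Definition dFup (t : R) (x : 'rV[R]_m) (i : 'I_m) (a : 'I_n) : R :=
  \sum_j ginv t x i j * dF t x j a.

Definition GammaM (t : R) (x : 'rV[R]_m) : 'I_m -> 'I_m -> 'I_m -> R :=
  christoffel (indg t) x.

Definition GammaN (t : R) (x : 'rV[R]_m) : 'I_n -> 'I_n -> 'I_n -> R :=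
  christoffel h (f t x).

(* A^a_(ij) *)
Definition sff (t : R) (x : 'rV[R]_m) (i j : 'I_m) (a : 'I_n) : R :=
  pder i (fun z => dF t z j a) x
  - \sum_k GammaM t x k i j * dF t x k a
  + \sum_b \sum_c GammaN t x a b c * dF t x i b * dF t x j c.

(* A^(a kl) *)
Definition sffup (t : R) (x : 'rV[R]_m) (k l : 'I_m) (a : 'I_n) : R :=
  \sum_i \sum_j ginv t x k i * ginv t x l j * sff t x i j a.

(* H^a *)
Definition meanH (t : R) (x : 'rV[R]_m) (a : 'I_n) : R :=
  \sum_i \sum_j ginv t x i j * sff t x i j a.

(* Covariant derivatives of sections V of F_t^* TN. *)
Definition nabla1 (t : R) (V : 'rV[R]_m -> 'I_n -> R) (x : 'rV[R]_m)
    (j : 'I_m) (a : 'I_n) : R :=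
  pder j (fun z => V z a) x
  + \sum_b \sum_c GammaN t x a b c * dF t x j b * V x c.

Definition nabla2 (t : R) (V : 'rV[R]_m -> 'I_n -> R) (x : 'rV[R]_m)
    (i j : 'I_m) (a : 'I_n) : R :=
  pder i (fun z => nabla1 t V z j a) x
  - \sum_k GammaM t x k i j * nabla1 t V x k a
  + \sum_b \sum_c GammaN t x a b c * dF t x i b * nabla1 t V x j c.

Definition laplacian (t : R) (V : 'rV[R]_m -> 'I_n -> R) (x : 'rV[R]_m)
    (a : 'I_n) : R :=
  \sum_i \sum_j ginv t x i j * nabla2 t V x i j a.

Definition laplacian0 (t : R) (phi : 'rV[R]_m -> R) (x : 'rV[R]_m) : R :=
  \sum_i \sum_j ginv t x i j *
    (pder i (fun z => pder j phi z) x - \sum_k GammaM t x k i j * pder k phi x).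

Definition ip (t : R) (x : 'rV[R]_m) (u v : 'I_n -> R) : R :=
  inner (h (f t x)) u v.

(* Orthogonal projection onto the normal space:
   v - g^(kl) <v, F_k> F_l *)
Definition normal_part (t : R) (x : 'rV[R]_m) (v : 'I_n -> R) (a : 'I_n) : R :=
  v a - \sum_k \sum_l ginv t x k l * ip t x v (dF t x k) * dF t x l a.

Definition nablaperp1 (t : R) (V : 'rV[R]_m -> 'I_n -> R) (x : 'rV[R]_m)
    (i : 'I_m) : 'I_n -> R := normal_part t x (nabla1 t V x i).

Definition normH2 (t : R) (x : 'rV[R]_m) : R :=
  ip t x (meanH t x) (meanH t x).

(* |B|^2 for a section B of T^*M (x) F_t^* TN *)
Definition norm1form2 (t : R) (x : 'rV[R]_m) (B : 'I_m -> 'I_n -> R) : R :=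
  \sum_i \sum_j ginv t x i j * ip t x (B i) (B j).

(* Covariant time derivative of H along a mean curvature flow, where the
   velocity dF/dt is H. *)
Definition nabla_dt_H (T : \bar R) (t : R) (x : 'rV[R]_m) (a : 'I_n) : R :=
  dtime T (fun s => meanH s x a) t
  + \sum_b \sum_c GammaN t x a b c * meanH t x b * meanH t x c.

(* C^k_(ij) *)
Definition dtGamma (T : \bar R) (t : R) (x : 'rV[R]_m) (k i j : 'I_m) : R :=
  dtime T (fun s => GammaM s x k i j) t.

End Immersion.
End Coordinates.

Definition local_rep (R : realType) (m n : nat) (M : smooth_manifold R m)
    (N : smooth_manifold R n) (F : M -> R -> N) (c : chart R m M)
    (d : chart R n N) (t : R) (x : 'rV[R]_m) : 'rV[R]_n :=
  cmap d (F (cinv c x) t).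

(* Smoothness of F on M x [0, T), a manifold with boundary {t = 0}: near every
   point, and in all charts, F extends to a smooth map on an open subset of
   R^m x R. The values F p t for t outside [0, T) are irrelevant. *)
Definition smooth_family (R : realType) (m n : nat) (M : smooth_manifold R m)
    (N : smooth_manifold R n) (T : \bar R) (F : M -> R -> N) : Prop :=
  forall c d p t, atlas c -> atlas d -> cdom c p -> time_interval T t ->
    cdom d (F p t) ->
  exists (U : set ('rV[R]_m * R^o)) (G : 'rV[R]_m * R^o -> 'rV[R]_n),
    [/\ open U, U (cmap c p, t), smooth_on U G &
        forall x s, U (x, s) -> cimg c x -> time_interval T s ->
          cdom d (F (cinv c x) s) /\ local_rep F c d s x = G (x, s)].

Record mcf_solution (R : realType) (m n : nat) (M : smooth_manifold R m)
    (N : smooth_manifold R n) (g : riemannian_metric N) (T : \bar R)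
    (F : M -> R -> N) : Prop := MCFSolution {
  mcf_smooth : smooth_family T F;
  mcf_immersion : forall c d p t, atlas c -> atlas d -> cdom c p ->
    time_interval T t -> cdom d (F p t) ->
    row_free ('J (local_rep F c d t) (cmap c p));
  mcf_equation : forall c d p t, atlas c -> atlas d -> cdom c p ->
    time_interval T t -> cdom d (F p t) -> forall a,
    dtime T (fun s => local_rep F c d s (cmap c p) 0 a) t
    = meanH (gcomp g d) (local_rep F c d) t (cmap c p) a }.

(* Main.v *)
Require Import Defs.
From HB Require Import structures.
From mathcomp Require Import all_boot all_order all_algebra.
From mathcomp Require Import boolp classical_sets functions cardinality reals.
From mathcomp Require Import ereal topology normedtype landau derive.
From mathcomp Require Import ring.

Set Implicit Arguments.
Unset Strict Implicit.
Unset Printing Implicit Defensive.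

Import Order.TTheory GRing.Theory Num.Theory.
Import numFieldNormedType.Exports.

Local Open Scope classical_set_scope.
Local Open Scope ring_scope.

(** The proof is the coordinate-free computation.  Near the given point the flow
    extends to a smooth map G on an open subset of space-time, so time is one
    more coordinate direction and a single calculus covers spatial and time
    derivatives: the pull-back by G of the Levi-Civita connection of the target
    ([pull_nabla]).  This connection is metric ([derive_inner]), torsion free
    ([pull_nabla_velocity], which says that the covariant derivative of d_i G in
    the direction j is symmetric in i and j), and covariant derivatives in two
    constant directions commute up to the curvature ([pull_nabla_comm]).

    The second fundamental form A_ij is nabla_i (d_j G) minus its tangential
    part, and the Christoffel symbols of the induced metric are exactly what
    makes A normal ([second_form_normal]).  Torsion freeness and the Ricci
    identity then give
      nabla_t nabla_i d_j G = nabla_i nabla_t d_j G + R(H, d_i G) d_j G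
                            = nabla_i nabla_j H + R(H, d_i G) d_j G,
    while H being normal gives <nabla_k H, d_l G> = - <A_kl, H>, so the induced
    metric evolves by - 2 <A_kl, H> and its inverse by the opposite sign.
    Differentiating H = g^ij A_ij in time yields the first formula
    ([nabla_tau_mean_curvature]).

    Pairing with H kills the Christoffel term, which is tangential, and the
    Bochner identity for the Laplacian of |H|^2 ([laplacian_norm]) yields the
    second formula.  The third follows from the second by Pythagoras, since the
    tangential part of nabla_i H is given by - <A_ij, H> ([norm_nabla_split]).

    The equation dG/dt = H is available only at times of the flow; at time 0 the
    extension to negative times satisfies no equation.  Therefore H is replaced
    by dG/dt only on the time slice, where it is differentiated in spatial
    directions; the time derivative of H is always taken of its expression
    g^ij A_ij. *)

(** * Calculus of functions of class C^k *)

Section CkGeneral.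
Context {R : realType} {V W : normedModType R}.
Implicit Types (U : set V) (f g : V -> W).

Lemma near_eq_in U f g x : open U -> {in U, f =1 g} -> U x ->
  \forall y \near x, f y = g y.
Proof.
move=> oU fg Ux; have := open_nbhs_nbhs (conj oU Ux).
by apply: filterS => y Uy; apply: fg; rewrite inE.
Qed.

Lemma derive_eq_in U f g v x : open U -> {in U, f =1 g} -> U x ->
  'D_v f x = 'D_v g x.
Proof. by move=> oU fg Ux; apply/near_eq_derive/(near_eq_in oU fg Ux). Qed.

(** The first-order expansion only involves the germ of the function, so the
    differential of [f] serves for [g]. *)
Lemma near_eq_differentiable f g (x : V) : (\near x, f x = g x) ->
  differentiable f x -> differentiable g x.
Proof.
move=> fg dfx.
have fgx : f x = g x by apply: nbhs_singleton fg.
have cd : continuous ('d f x) by exact: diff_continuous.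
have gE : g \o shift x = cst (g x) + 'd f x +o_ (0 : V) id.
  have /eqaddoP fE := diff_locally dfx.
  apply/eqaddoP => e e0; have nf := fE e e0.
  have ng : \forall h \near 0, f (h + x) = g (h + x).
    by move: fg; rewrite (near_shift 0) subr0.
  apply: filterS2 nf ng => h; rewrite !fctE /= -fgx => + <-.
  exact.
have dE := diff_unique cd gE.
apply/diff_locallyP; rewrite dE; split; first exact: cd.
exact: gE.
Qed.

(** The recursion differentiates functions defined everywhere, so identities
    valid on U only, such as the Leibniz and chain rules, enter through this
    lemma. *)
Lemma Ck_eq_in k U f g : open U -> {in U, f =1 g} -> Ck k U f -> Ck k U g.
Proof.
move=> oU; elim: k f g => [|k IH] f g fg /=.
  move=> cf x Ux; have nfg := near_eq_in oU fg Ux.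
  change (g @ x --> g x); rewrite -(nbhs_singleton nfg).
  exact/(cvg_trans _ (cf x Ux))/near_eq_cvg.
move=> [df Df]; split=> [x Ux|v].
  exact: near_eq_differentiable (near_eq_in oU fg Ux) (df x Ux).
apply: IH (Df v) => x; rewrite inE => Ux; exact: derive_eq_in fg Ux.
Qed.

Lemma CkS k U f : Ck k.+1 U f -> Ck k U f.
Proof.
elim: k f => [|k IH] f.
  by move=> [df _] x Ux; apply: differentiable_continuous (df x Ux).
by move=> [df Df]; split=> // v; apply: IH (Df v).
Qed.

Lemma Ck_sub k U U' f : U' `<=` U -> Ck k U f -> Ck k U' f.
Proof.
move=> sU; elim: k f => [|k IH] f /=; first by move=> cf x /sU /cf.
by move=> [df Df]; split=> [x /sU /df //|v]; apply: IH (Df v).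
Qed.

Lemma Ck_cst k U (w : W) : Ck k U (cst w).
Proof.
elim: k w => [|k IH] w /=; first by move=> x _; apply: cst_continuous.
split=> [x _|v]; first exact: differentiable_cst.
suff -> : (fun x => 'D_v (cst w) x) = cst (0 : W) by exact: IH.
by apply/funext => x; rewrite derive_cst.
Qed.

Lemma Ck_add k U f g : open U -> Ck k U f -> Ck k U g ->
  Ck k U (fun x => f x + g x).
Proof.
move=> oU; elim: k f g => [|k IH] f g /=.
  by move=> cf cg x Ux; apply: continuousD; [apply: cf|apply: cg].
move=> [df Df] [dg Dg]; split=> [x Ux|v].
  by apply: differentiableD; [apply: df|apply: dg].
apply: Ck_eq_in (IH _ _ (Df v) (Dg v)) => // x; rewrite inE => Ux.
by rewrite deriveD //; apply/diff_derivable; [apply: df|apply: dg].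
Qed.

End CkGeneral.

Section CkReal.
Context {R : realType} {V : normedModType R}.
Implicit Types (U : set V) (f g : V -> R^o).

Lemma Ck_mul k U f g : open U -> Ck k U f -> Ck k U g ->
  Ck k U ((fun x => f x * g x) : V -> R^o).
Proof.
move=> oU; elim: k f g => [|k IH] f g.
  by move=> cf cg x Ux; apply: continuousM; [apply: cf|apply: cg].
move=> Cf Cg; have [df Df] := Cf; have [dg Dg] := Cg; split=> [x Ux|v].
  by apply: differentiableM; [apply: df|apply: dg].
have Ck' := Ck_add oU (IH _ _ (CkS Cf) (Dg v)) (IH _ _ (CkS Cg) (Df v)).
apply: Ck_eq_in Ck' => // x; rewrite inE => Ux; apply/esym.
by apply: deriveM; apply/diff_derivable; [apply: df|apply: dg].
Qed.

Lemma Ck_inv k U f : open U -> (forall x, U x -> f x != 0) -> Ck k U f ->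
  Ck k U ((fun x => (f x)^-1) : V -> R^o).
Proof.
move=> oU f0; elim: k f f0 => [|k IH] f f0.
  by move=> cf x Ux; apply: continuousV; [apply: f0|apply: cf].
move=> Cf; have [df Df] := Cf; split=> [x Ux|v].
  by apply: differentiableV; [apply: df|apply: f0].
have Ci := IH _ f0 (CkS Cf).
have CD := Ck_mul oU (Ck_cst k U (-1 : R^o)) (Ck_mul oU (Ck_mul oU Ci Ci) (Df v)).
apply: Ck_eq_in CD => // x; rewrite inE => Ux; apply/esym.
rewrite deriveV; [|exact: f0|exact/diff_derivable/df].
by rewrite /cst /= mulN1r scaleNr -mulNr /GRing.scale /= expr2 invfM mulNr.
Qed.

End CkReal.

Section CkCoord.
Context {R : realType} {V : normedModType R}.

Lemma derive_coord m n (f : V -> 'M[R]_(m, n)) i j v x : differentiable f x ->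
  'D_v ((fun x => f x i j) : V -> R^o) x = 'D_v f x i j.
Proof.
move=> df; rewrite derive_mx; last exact: diff_derivable.
by rewrite mxE.
Qed.

Lemma differentiable_entry m n (f : V -> 'M[R]_(m, n)) i j x :
  differentiable f x -> differentiable ((fun x => f x i j) : V -> R^o) x.
Proof.
move=> df.
exact: (differentiable_comp df (differentiable_coord (f x) i j)).
Qed.

Lemma Ck_coord k m n (U : set V) (f : V -> 'M[R]_(m, n)) i j : open U ->
  Ck k U f -> Ck k U ((fun x => f x i j) : V -> R^o).
Proof.
move=> oU; elim: k f => [|k IH] f.
  move=> cf x Ux; have := cf x Ux.
  move=> /(continuous_comp (g := fun M : 'M[R]_(m, n) => M i j)); apply.
  exact: coord_continuous.
move=> [df Df]; split=> [x Ux|v]; first exact: differentiable_entry (df x Ux).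
apply: Ck_eq_in (IH _ (Df v)) => // x; rewrite inE => Ux.
by rewrite derive_coord //; apply: df.
Qed.

Lemma derive_comp n (phi : 'rV[R]_n -> R^o) (G : V -> 'rV[R]_n) v x :
  differentiable G x -> differentiable phi (G x) ->
  'D_v (fun y => phi (G y)) x
  = \sum_e 'D_(delta_mx 0 e) phi (G x) * 'D_v ((fun y => G y 0 e) : V -> R^o) x.
Proof.
move=> dG dphi.
rewrite deriveE; last exact: (differentiable_comp dG dphi).
rewrite (diff_comp dG dphi) /= -(deriveE v dG).
rewrite [X in 'd phi _ X]row_sum_delta linear_sum; apply: eq_bigr => e _.
by rewrite linearZ /= -(deriveE _ dphi) derive_coord // mulrC.
Qed.

End CkCoord.

Section CkComp.
Context {R : realType} {V : normedModType R}.

Lemma Ck_sum (I : finType) k (U : set V) (f : I -> V -> R^o) :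
  open U -> (forall i, Ck k U (f i)) ->
  Ck k U ((fun x => \sum_i f i x) : V -> R^o).
Proof.
move=> oU Cf.
have E : Ck k U ((fun x => \sum_(i <- index_enum I) f i x) : V -> R^o).
  elim: (index_enum I) => [|i r IH].
    by under [X in Ck _ _ X]eq_fun do rewrite big_nil; apply: Ck_cst.
  under [X in Ck _ _ X]eq_fun do rewrite big_cons.
  exact: (Ck_add oU (Cf i) IH).
exact: E.
Qed.

Lemma Ck_prod (I : finType) k (U : set V) (f : I -> V -> R^o) :
  open U -> (forall i, Ck k U (f i)) ->
  Ck k U ((fun x => \prod_i f i x) : V -> R^o).
Proof.
move=> oU Cf.
have E : Ck k U ((fun x => \prod_(i <- index_enum I) f i x) : V -> R^o).
  elim: (index_enum I) => [|i r IH].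
    by under [X in Ck _ _ X]eq_fun do rewrite big_nil; apply: (Ck_cst k U (1 : R^o)).
  under [X in Ck _ _ X]eq_fun do rewrite big_cons.
  exact: (Ck_mul oU (Cf i) IH).
exact: E.
Qed.

(** By the chain rule the derivatives of the composite are sums of products of
    functions to which the induction hypothesis applies. *)
Lemma Ck_comp n k (U : set V) (O : set 'rV[R]_n) (phi : 'rV[R]_n -> R^o)
    (G : V -> 'rV[R]_n) : open U -> (forall x, U x -> O (G x)) ->
  Ck k O phi -> Ck k U G -> Ck k U ((fun x => phi (G x)) : V -> R^o).
Proof.
move=> oU UO; elim: k phi => [|k IH] phi.
  move=> cphi cG x Ux.
  exact: (continuous_comp (cG x Ux) (cphi _ (UO _ Ux))).
move=> [dphi Dphi] CG; have [dG DG] := CG; split=> [x Ux|v].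
  exact: (differentiable_comp (dG x Ux) (dphi _ (UO _ Ux))).
have C' : Ck k U ((fun x => \sum_e 'D_(delta_mx 0 e) phi (G x)
    * 'D_v ((fun y => G y 0 e) : V -> R^o) x) : V -> R^o).
  apply: Ck_sum => // e; apply: Ck_mul => //; first exact: IH (Dphi _) (CkS CG).
  exact: (Ck_coord 0 e oU CG).2.
apply: Ck_eq_in C' => // x; rewrite inE => Ux; apply/esym/derive_comp.
  exact: dG.
exact/dphi/UO.
Qed.

End CkComp.

(** * Symmetry of second derivatives *)

Lemma second_difference_swap (V : zmodType) (a b c d : V) :
  a - b - (c - d) = a - c - (b - d).
Proof. by rewrite !opprB addrACA [RHS]addrACA [- b - c]addrC. Qed.

Lemma dist_split_le (R : realFieldType) (e x y z : R) :
  `|x - z| < e / 2 -> `|y - z| < e / 2 -> `|x - y| <= e.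
Proof.
move=> xz yz; rewrite (le_trans (ler_distD z _ _)) // (splitr e) lerD ?ltW //.
by rewrite distrC.
Qed.

Section Schwarz.
Context {R : realType} {V : normedModType R}.
Implicit Types (f : V -> R^o) (U : set V).

Lemma is_derive_line f (w q : V) (r : R) :
  differentiable f (r *: w + q) ->
  is_derive r 1 ((fun r : R => f (r *: w + q)) : R -> R) ('D_w f (r *: w + q)).
Proof.
move=> df; have := derivableP (@diff_derivable _ _ _ _ _ w df).
have E : (fun h : R => h^-1 *: (f (h *: w + (r *: w + q)) - f (r *: w + q)))
  = (fun h => h^-1 *: (f ((h *: (1 : R) + r) *: w + q) - f (r *: w + q))).
  by apply/funext => h; rewrite scalerDl addrA /GRing.scale /= mulr1.
by move=> [d _]; apply: DeriveDef; move: d; rewrite /derivable /derive /= E.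
Qed.

Lemma line_MVT f (w q : V) (s : R) : 0 < s ->
  (forall r, 0 <= r <= s -> differentiable f (r *: w + q)) ->
  exists2 r, 0 <= r <= s & f (s *: w + q) - f q = s * 'D_w f (r *: w + q).
Proof.
move=> s0 df.
have [||r + E] := @MVT _ ((fun r : R => f (r *: w + q)) : R -> R)
    (fun r => 'D_w f (r *: w + q)) 0 s s0.
- move=> r; rewrite in_itv /= => /andP[r0 rs]; apply: is_derive_line.
  by apply: df; rewrite !ltW.
- apply: derivable_within_continuous => r; rewrite in_itv /= => rs.
  by have [] := is_derive_line (df r rs).
rewrite in_itv /= => /andP[r0 rs]; exists r; first by rewrite !ltW.
by rewrite scale0r add0r subr0 in E; rewrite E mulrC.
Qed.

(** The second difference over a square of side [s] is an increment of the
    function y |-> f (y + s v) - f y; the mean value theorem in the direction w,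
    then in the direction v, turns it into a mixed derivative. *)
Lemma square_MVT f U (v w p : V) (s : R) : open U -> Ck 2 U f -> 0 < s ->
  (forall a b, 0 <= a <= s -> 0 <= b <= s -> U (a *: v + (b *: w + p))) ->
  exists a b, [/\ 0 <= a <= s, 0 <= b <= s &
    f (s *: v + (s *: w + p)) - f (s *: v + p) - (f (s *: w + p) - f p)
    = s ^+ 2 * 'D_v ('D_w f) (a *: v + (b *: w + p))].
Proof.
move=> oU [df Df] s0 sU.
have s_in : 0 <= s <= s by rewrite ltW //=.
have o_in : 0 <= (0 : R) <= s by rewrite lexx ltW.
pose phi : V -> R^o := (f \o shift (s *: v)) - f.
have dshift x : differentiable (f \o shift (s *: v)) x <->
    differentiable f (x + s *: v).
  split=> d.
    have := @differentiable_comp _ _ _ _ (shift (- (s *: v)))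
      (f \o shift (s *: v)) (x + s *: v).
    have -> : (f \o shift (s *: v)) \o shift (- (s *: v)) = f.
      by apply/funext => y /=; rewrite subrK.
    apply; last by rewrite /= addrK.
    exact: differentiableD.
  by apply: differentiable_comp => //; apply: differentiableD.
have DU b : 0 <= b <= s -> U (b *: w + p + s *: v).
  by move=> bs; rewrite addrC; apply: sU.
have DU0 b : 0 <= b <= s -> U (b *: w + p).
  by move=> bs; have := sU 0 b o_in bs; rewrite scale0r add0r.
have dphi r : 0 <= r <= s -> differentiable phi (r *: w + p).
  move=> rs; apply: differentiableB; last exact/df/DU0.
  exact/dshift/df/DU.
have [b bs E] := line_MVT s0 dphi.
have D1 : 'D_w phi (b *: w + p)
   = 'D_w f (s *: v + (b *: w + p)) - 'D_w f (b *: w + p).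
  rewrite deriveB; first last.
  - exact/diff_derivable/df/DU0.
  - exact/diff_derivable/dshift/df/DU.
  congr (_ - _); rewrite /derive /=.
  set g1 := (X in lim (X @ _)); set g2 := (X in _ = lim (X @ _)).
  suff -> : g1 = g2 by [].
  by apply/funext => h; rewrite /g1 /g2 /= [s *: v + _]addrC !addrA.
have [a as_ E'] := @line_MVT ('D_w f) v (b *: w + p) s s0
  (fun r rs => (Df w).1 _ (sU _ _ rs bs)).
exists a, b; split=> //.
have -> : f (s *: v + (s *: w + p)) - f (s *: v + p) - (f (s *: w + p) - f p)
   = phi (s *: w + p) - phi p.
  rewrite /phi !fctE /= [s *: w + p + _]addrC [p + _]addrC.
  exact: second_difference_swap.
by rewrite E D1 E' expr2 mulrA.
Qed.

(** Both iterated derivatives are the limit of the same second difference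
    quotient, which is symmetric in the two directions. *)
Lemma derive_comm f U (v w p : V) : open U -> Ck 2 U f -> U p ->
  'D_v ('D_w f) p = 'D_w ('D_v f) p.
Proof.
move=> oU Cf Up; have [_ Df] := Cf.
apply/eqP; rewrite -subr_eq0 -normr_le0; apply/ler_addgt0Pl => e e0.
rewrite addr0.
have near_cont g : {for p, continuous (g : V -> R^o)} ->
    \forall y \near p, `|g p - g y| < e / 2.
  by move=> /cvgrPdist_lt; apply; rewrite divr_gt0.
have n1 := near_cont _ ((Df w).2 v p Up).
have n2 := near_cont _ ((Df v).2 w p Up).
have n3 : nbhs p U by exact: open_nbhs_nbhs.
pose P y := (`|'D_v ('D_w f) p - 'D_v ('D_w f) y| < e / 2 /\
  `|'D_w ('D_v f) p - 'D_w ('D_v f) y| < e / 2) /\ U y.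
have nP : nbhs p P by exact: filterI (filterI n1 n2) n3.
have /nbhs_ballP [d /= d0] := nP.
rewrite -ball_normE => dP.
(* The side s keeps the whole square inside the ball of radius d around p. *)
pose s := d / 2 / (`|v| + `|w| + 1).
have vw0 : 0 < `|v| + `|w| + 1 by rewrite ltr_wpDl // addr_ge0.
have s0 : 0 < s by rewrite !divr_gt0.
have box a b : 0 <= a <= s -> 0 <= b <= s -> `|p - (a *: v + (b *: w + p))| < d.
  move=> /andP[a0 as_] /andP[b0 bs].
  rewrite -normrN opprB addrA addrK (le_lt_trans (ler_normD _ _)) //.
  rewrite !normrZ !ger0_norm //.
  have : a * `|v| + b * `|w| <= s * (`|v| + `|w| + 1).
    rewrite mulrDr mulrDr; apply: ler_wpDr; first by rewrite mulr1 ltW.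
    by apply: lerD; apply: ler_wpM2r.
  move=> /le_lt_trans; apply; rewrite /s divfK ?gt_eqF //.
  by rewrite ltr_pdivrMr // ltr_pMr // ltr1n.
have [a [b [as_ bs E1]]] := square_MVT oU Cf s0
  (fun a b ha hb => (dP _ (box a b ha hb)).2).
have box' a' b' : 0 <= a' <= s -> 0 <= b' <= s ->
    `|p - (a' *: w + (b' *: v + p))| < d.
  by move=> ha hb; rewrite addrCA; apply: box.
have [a' [b' [as' bs' E2]]] := square_MVT oU Cf s0
  (fun a b ha hb => (dP _ (box' a b ha hb)).2).
have E : 'D_v ('D_w f) (a *: v + (b *: w + p))
       = 'D_w ('D_v f) (a' *: w + (b' *: v + p)).
  have s20 : s ^+ 2 != 0 by rewrite expf_neq0 // gt_eqF.
  have K (x y : R) : s ^+ 2 * x = s ^+ 2 * y -> x = y by exact: (mulfI s20).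
  apply: K; rewrite [LHS](esym E1) [RHS](esym E2).
  by rewrite [s *: v + (s *: w + p)]addrCA; exact: second_difference_swap.
have [[k1 _] _] := dP _ (box _ _ as_ bs).
have [[_ k2] _] := dP _ (box' _ _ as' bs').
rewrite /= in k1 k2; rewrite E in k1.
exact: dist_split_le k1 k2.
Qed.

End Schwarz.

(** * Smooth real functions *)

Section Smooth.
Context {R : realType} {V : normedModType R}.
Implicit Types (f g : V -> R^o) (U : set V).

Lemma smooth_eq_in U f g : open U -> {in U, f =1 g} ->
  smooth_on U f -> smooth_on U g.
Proof. by move=> oU fg sf k; apply: Ck_eq_in (sf k). Qed.

Lemma smooth_cst U (a : R^o) : smooth_on U (cst a : V -> R^o).
Proof. by move=> k; apply: Ck_cst. Qed.

Lemma smooth_add U f g : open U -> smooth_on U f -> smooth_on U g ->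
  smooth_on U ((fun x => f x + g x) : V -> R^o).
Proof. by move=> oU sf sg k; apply: Ck_add. Qed.

Lemma smooth_mul U f g : open U -> smooth_on U f -> smooth_on U g ->
  smooth_on U ((fun x => f x * g x) : V -> R^o).
Proof. by move=> oU sf sg k; apply: Ck_mul. Qed.

Lemma smooth_opp U f : open U -> smooth_on U f ->
  smooth_on U ((fun x => - f x) : V -> R^o).
Proof.
move=> oU sf; apply: smooth_eq_in (smooth_mul oU (smooth_cst U (-1)) sf) => //.
by move=> x _; rewrite /cst mulN1r.
Qed.

Lemma smooth_inv U f : open U -> (forall x, U x -> f x != 0) ->
  smooth_on U f -> smooth_on U ((fun x => (f x)^-1) : V -> R^o).
Proof. by move=> oU f0 sf k; apply: Ck_inv. Qed.

Lemma smooth_sum (I : finType) U (f : I -> V -> R^o) : open U ->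
  (forall i, smooth_on U (f i)) -> smooth_on U ((fun x => \sum_i f i x) : V -> R^o).
Proof. by move=> oU sf k; apply: Ck_sum => // i; apply: sf. Qed.

Lemma smooth_prod (I : finType) U (f : I -> V -> R^o) : open U ->
  (forall i, smooth_on U (f i)) -> smooth_on U ((fun x => \prod_i f i x) : V -> R^o).
Proof. by move=> oU sf k; apply: Ck_prod => // i; apply: sf. Qed.

Lemma smooth_derive U f v : smooth_on U f -> smooth_on U ('D_v f : V -> R^o).
Proof. by move=> sf k; apply: (sf k.+1).2. Qed.

Lemma smooth_differentiable U f x : smooth_on U f -> U x -> differentiable f x.
Proof. by move=> sf; apply: (sf 1).1. Qed.

Lemma smooth_derivable U f x v : smooth_on U f -> U x -> derivable f x v.
Proof. by move=> sf Ux; apply/diff_derivable/(smooth_differentiable sf). Qed.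

Lemma smooth_det U k (f : V -> 'M[R]_k) : open U ->
  (forall i j, smooth_on U ((fun x => f x i j) : V -> R^o)) ->
  smooth_on U ((fun x => \det (f x)) : V -> R^o).
Proof.
move=> oU sf; rewrite /determinant; apply: smooth_sum => // s.
apply: smooth_mul => //; first exact: smooth_cst.
by apply: smooth_prod => // i.
Qed.

(** Cramer's rule: the entries of the inverse are quotients of polynomials in
    the entries. *)
Lemma smooth_invmx U k (f : V -> 'M[R]_k) : open U ->
  (forall x, U x -> f x \in unitmx) ->
  (forall i j, smooth_on U ((fun x => f x i j) : V -> R^o)) ->
  forall i j, smooth_on U ((fun x => invmx (f x) i j) : V -> R^o).
Proof.
move=> oU fU sf i j.
have C : smooth_on U
    ((fun x => (\det (f x))^-1 * cofactor (f x) j i) : V -> R^o).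
  apply: smooth_mul => //.
    apply: smooth_inv => //; last exact: smooth_det.
    by move=> x /fU; rewrite unitmxE unitfE.
  rewrite /cofactor; apply: smooth_mul => //; first exact: smooth_cst.
  apply: smooth_det => // a b.
  by apply: smooth_eq_in (sf (lift j a) (lift i b)) => // x _; rewrite !mxE.
apply: smooth_eq_in C => // x; rewrite inE => /fU ux.
by rewrite /invmx ux /= !mxE.
Qed.

End Smooth.

(** * Bilinear algebra *)

Lemma sum4_exchange (R : nmodType) (I J : finType) (f : I -> I -> J -> J -> R) :
  \sum_i \sum_j \sum_k \sum_l f i j k l = \sum_k \sum_l \sum_i \sum_j f i j k l.
Proof.
under eq_bigr => i _ do rewrite exchange_big.
rewrite exchange_big; apply: eq_bigr => k _ /=.
under eq_bigr => i _ do rewrite exchange_big.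
by rewrite exchange_big.
Qed.

Section Inner.
Context {R : realType} {k : nat}.
Implicit Types (G : 'M[R]_k) (u v w : 'I_k -> R).

Lemma innerDl G u v w :
  inner G (fun a => u a + v a) w = inner G u w + inner G v w.
Proof.
rewrite /inner -big_split; apply: eq_bigr => a _; rewrite -big_split.
by apply: eq_bigr => b _; rewrite /= mulrDr mulrDl.
Qed.

Lemma innerZl G (c : R) u w : inner G (fun a => c * u a) w = c * inner G u w.
Proof.
rewrite /inner mulr_sumr; apply: eq_bigr => a _; rewrite mulr_sumr.
by apply: eq_bigr => b _; rewrite /= [G a b * _]mulrCA !mulrA.
Qed.

Lemma innerBl G u v w :
  inner G (fun a => u a - v a) w = inner G u w - inner G v w.
Proof.
rewrite -mulN1r -innerZl -innerDl; congr inner.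
by apply/funext => a; rewrite mulN1r.
Qed.

Lemma inner_suml (I : finType) G (c : I -> R) (u : I -> 'I_k -> R) w :
  inner G (fun a => \sum_i c i * u i a) w = \sum_i c i * inner G (u i) w.
Proof.
have E (r : seq I) : inner G (fun a => \sum_(i <- r) c i * u i a) w
    = \sum_(i <- r) c i * inner G (u i) w.
  elim: r => [|i r IH].
    rewrite big_nil /inner big1 // => a _; rewrite big1 // => b _.
    by rewrite big_nil mulr0 mul0r.
  rewrite big_cons -IH -innerZl -innerDl; congr inner.
  by apply/funext => a; rewrite big_cons.
exact: E.
Qed.

Lemma inner_sum (I : finType) G (u : I -> 'I_k -> R) w :
  inner G (fun a => \sum_i u i a) w = \sum_i inner G (u i) w.
Proof.
transitivity (inner G (fun a => \sum_i 1 * u i a) w).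
  by congr inner; apply/funext => a; apply: eq_bigr => i _; rewrite mul1r.
by rewrite inner_suml; apply: eq_bigr => i _; rewrite mul1r.
Qed.

Lemma innerC G u v : G^T = G -> inner G u v = inner G v u.
Proof.
move=> sG; rewrite /inner exchange_big; apply: eq_bigr => a _.
by apply: eq_bigr => b _; rewrite -[in LHS]sG mxE mulrAC.
Qed.

End Inner.

(** * Christoffel symbols and curvature *)

Section ChristoffelNumbers.
Context {R : realType} {k : nat}.
Implicit Types (g : 'M[R]_k) (dg : 'I_k -> 'I_k -> 'I_k -> R).

(** [dg i j l] stands for the derivative of g_jl in the direction i.  Taking
    these numbers as data makes the algebra apply both to the target metric,
    differentiated in a chart, and to the induced metric, differentiated along
    directions of space-time. *)
Definition christoffel_of g dg (a i j : 'I_k) : R :=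
  2^-1 * \sum_l invmx g a l * (dg i j l + dg j i l - dg l i j).

Lemma christoffel_of_sym g dg a i j : (forall l i j, dg l i j = dg l j i) ->
  christoffel_of g dg a i j = christoffel_of g dg a j i.
Proof.
move=> sdg; congr (_ * _); apply: eq_bigr => l _.
by rewrite [dg j i l + _]addrC (sdg l j i).
Qed.

Lemma christoffel_of_lower g dg l i j : g \in unitmx ->
  \sum_a g l a * christoffel_of g dg a i j
  = 2^-1 * (dg i j l + dg j i l - dg l i j).
Proof.
move=> ug; pose X b := dg i j b + dg j i b - dg b i j.
transitivity (2^-1 * \sum_b (g *m invmx g) l b * X b).
  transitivity (2^-1 * \sum_b \sum_a g l a * (invmx g a b * X b)).
    rewrite exchange_big mulr_sumr; apply: eq_bigr => a _ /=.
    by rewrite /christoffel_of mulrCA mulr_sumr.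
  congr (_ * _); apply: eq_bigr => b _; rewrite mxE mulr_suml.
  by apply: eq_bigr => a _; rewrite mulrA.
rewrite mulmxV // (bigD1 l) //= mxE eqxx mul1r big1 ?addr0 // => b bl.
by rewrite mxE eq_sym (negPf bl) mul0r.
Qed.

(** Metric compatibility: adding two lowered symbols cancels all but one of the
    derivatives of the metric. *)
Lemma christoffel_of_compat g dg c a b : g \in unitmx ->
  (forall l i j, dg l i j = dg l j i) ->
  dg c a b = \sum_d (g a d * christoffel_of g dg d c b
                     + g b d * christoffel_of g dg d c a).
Proof.
move=> ug sdg; rewrite big_split /= !christoffel_of_lower //.
by rewrite (sdg b c a) (sdg a c b) (sdg c b a) (sdg b a c); field.
Qed.

End ChristoffelNumbers.

Section RiemannCoordinates.
Context {R : realType} {n : nat} (h : 'rV[R]_n -> 'M[R]_n).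

(** R^a_(bcd), written out with Christoffel symbols. *)
Definition riem (y : 'rV[R]_n) (a b c d : 'I_n) : R :=
  pder c (fun z => christoffel h z a d b) y
  - pder d (fun z => christoffel h z a c b) y
  + \sum_e (christoffel h y a c e * christoffel h y e d b
            - christoffel h y a d e * christoffel h y e c b).

Lemma pder_cst (c : 'I_n) (r : R) y : pder c (fun _ => r) y = 0.
Proof. exact: (derive_cst (r : R^o)). Qed.

Lemma sum_coord_field (c : 'I_n) y (f : 'I_n -> R) :
  \sum_b f b * coord_field c y b = f c.
Proof.
rewrite (bigD1 c) //= /coord_field eqxx mulr1 big1 ?addr0 // => b bc.
by rewrite (negPf bc) mulr0.
Qed.

Lemma levi_civita_coord (c : 'I_n) (Y : vfield) y a :
  levi_civita h (coord_field c) Y y a =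
  pder c (fun z => Y z a) y + \sum_b christoffel h y a c b * Y y b.
Proof.
rewrite /levi_civita; under eq_bigr do rewrite mulrC.
by rewrite sum_coord_field.
Qed.

(** Coordinate fields have constant components, so their brackets vanish and
    only derivatives of Christoffel symbols and quadratic terms remain. *)
Lemma riemann_coord (c d b : 'I_n) y a :
  riemann h (coord_field c) (coord_field d) (coord_field b) y a
  = riem y a b c d.
Proof.
have LC c' d' : levi_civita h (coord_field c') (coord_field d')
    = (fun y a => christoffel h y a c' d').
  apply/funext => z; apply/funext => a'; rewrite levi_civita_coord.
  by rewrite pder_cst add0r sum_coord_field.
rewrite /riemann !LC !levi_civita_coord.
rewrite [levi_civita _ _ _ _ _]big1 ?subr0; last first.
  move=> e _; rewrite [lie_bracket _ _ _ _]big1 ?mul0r // => i _.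
  by rewrite !pder_cst !mulr0 subrr.
by rewrite /riem sumrB opprD addrACA.
Qed.

Lemma Rlow_riem y a b c d :
  Rlow h y a b c d = \sum_j h y a j * riem y j b c d.
Proof.
rewrite /Rlow /inner exchange_big; apply: eq_bigr => j _ /=.
under eq_bigr do rewrite riemann_coord mulrAC.
rewrite (bigD1 a) //= /coord_field eqxx mulr1 big1 ?addr0 // => i ia.
by rewrite (negPf ia) mulr0.
Qed.

Lemma Rup_riem y a b c d : h y \in unitmx -> Rup h y a b c d = riem y a b c d.
Proof.
move=> uh; rewrite /Rup.
transitivity (\sum_j (invmx (h y) *m h y) a j * riem y j b c d).
  under eq_bigr do rewrite Rlow_riem mulr_sumr.
  rewrite exchange_big; apply: eq_bigr => j _; rewrite mxE mulr_suml.
  by apply: eq_bigr => i _; rewrite mulrA.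
rewrite mulVmx // (bigD1 a) //= mxE eqxx mul1r big1 ?addr0 // => j ja.
by rewrite mxE eq_sym (negPf ja) mul0r.
Qed.

End RiemannCoordinates.

(** * The pull-back of the Levi-Civita connection *)

Section TargetMetric.
Context {R : realType} {n : nat} (h : 'rV[R]_n -> 'M[R]_n) (O : set 'rV[R]_n).
Context (oO : open O) (sh : smooth_on O h).
Context (symh : forall y, O y -> (h y)^T = h y).
Context (unith : forall y, O y -> h y \in unitmx).

Lemma smooth_metric a b : smooth_on O ((fun y => h y a b) : 'rV[R]_n -> R^o).
Proof. by move=> k; apply: Ck_coord. Qed.

Lemma metric_sym y a b : O y -> h y a b = h y b a.
Proof. by move=> /symh E; rewrite -[in LHS]E mxE. Qed.

Lemma pder_metric_sym y l a b : O y ->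
  pder l (fun z => h z a b) y = pder l (fun z => h z b a) y.
Proof.
move=> Oy; apply: (derive_eq_in (U := O)) => // z; rewrite inE => Oz.
exact: metric_sym.
Qed.

Lemma christoffelE y : christoffel h y =
  christoffel_of (h y) (fun i j l => pder i (fun z => h z j l) y).
Proof. by []. Qed.

Lemma christoffel_sym y a b c : O y ->
  christoffel h y a b c = christoffel h y a c b.
Proof.
move=> Oy; rewrite christoffelE; apply: christoffel_of_sym => l i j.
exact: pder_metric_sym.
Qed.

Lemma pder_metric y c a b : O y -> pder c (fun z => h z a b) y =
  \sum_d (h y a d * christoffel h y d c b + h y b d * christoffel h y d c a).
Proof.
move=> Oy; rewrite christoffelE.
rewrite -(@christoffel_of_compat _ _ _
  (fun i j l => pder i (fun z => h z j l) y)) //; first exact: unith.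
by move=> *; apply: pder_metric_sym.
Qed.

Lemma smooth_christoffel a b c :
  smooth_on O ((fun y => christoffel h y a b c) : 'rV[R]_n -> R^o).
Proof.
have sd i j l : smooth_on O
    ((fun y => pder i (fun z => h z j l) y) : 'rV[R]_n -> R^o).
  exact/smooth_derive/smooth_metric.
apply: smooth_mul => //; first exact: smooth_cst.
apply: smooth_sum => // l; apply: smooth_mul => //.
  by apply: smooth_invmx => // *; apply: smooth_metric.
apply: smooth_add => //; first exact: smooth_add.
exact: smooth_opp.
Qed.

Lemma mulr4_rot (x y z t : R) : x * y * z * t = x * z * t * y.
Proof. by ring. Qed.

(** Second covariant derivative of a section x, with first derivatives Dx and
    Dx' and connection forms c and c', expanded so that the terms in Dx and Dx'
    are visibly symmetric in the two directions. *)
Lemma second_derivative_algebra (Z : R) (T D x Dx Dx' : 'I_n -> R)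
    (c c' : 'I_n -> 'I_n -> R) a :
  Z + \sum_b ((D b + T b) * x b + c' a b * Dx b)
    + \sum_b c a b * (Dx' b + \sum_e c' b e * x e)
  = Z + \sum_b T b * x b + (\sum_b c' a b * Dx b + \sum_b c a b * Dx' b)
    + \sum_b (D b + \sum_e c a e * c' e b) * x b.
Proof.
have -> : \sum_b c a b * (Dx' b + \sum_e c' b e * x e)
   = \sum_b c a b * Dx' b + \sum_b (\sum_e c a e * c' e b) * x b.
  under eq_bigr do rewrite mulrDr mulr_sumr.
  rewrite big_split exchange_big; congr (_ + _); apply: eq_bigr => b _ /=.
  by rewrite mulr_suml; apply: eq_bigr => e _; rewrite mulrA.
under eq_bigr do rewrite mulrDl.
rewrite !big_split /=.
under [X in _ = _ + X]eq_bigr do rewrite mulrDl.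
rewrite big_split /=; ring.
Qed.

(** The part of the second covariant derivative that is of order zero in the
    section, antisymmetrised in the two directions, is the curvature. *)
Lemma curvature_algebra (Ga : 'I_n -> 'I_n -> 'I_n -> R)
    (dGa : 'I_n -> 'I_n -> 'I_n -> 'I_n -> R) (v w : 'I_n -> R) a b :
  \sum_c \sum_d dGa c a d b * v c * w d
  + \sum_e (\sum_c Ga a c e * v c) * (\sum_d Ga e d b * w d)
  = \sum_c \sum_d dGa c a d b * w c * v d
    + \sum_e (\sum_c Ga a c e * w c) * (\sum_d Ga e d b * v d)
    + \sum_c \sum_d (dGa c a d b - dGa d a c b
       + \sum_e (Ga a c e * Ga e d b - Ga a d e * Ga e c b)) * v c * w d.
Proof.
have P (u u' : 'I_n -> R) :
    \sum_e (\sum_c Ga a c e * u c) * (\sum_d Ga e d b * u' d)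
    = \sum_c \sum_d (\sum_e Ga a c e * Ga e d b) * u c * u' d.
  under eq_bigr do rewrite mulr_suml.
  rewrite exchange_big; apply: eq_bigr => c _ /=.
  under eq_bigr do rewrite mulr_sumr.
  rewrite exchange_big; apply: eq_bigr => d _ /=.
  by rewrite !mulr_suml; apply: eq_bigr => e _; rewrite !mulrA; congr (_ * _);
    rewrite mulrAC.
rewrite !P.
rewrite [X in _ = X + _ + _]exchange_big [X in _ = _ + X + _]exchange_big -!big_split.
apply: eq_bigr => c _; rewrite -!big_split; apply: eq_bigr => d _ /=.
rewrite sumrB; ring.
Qed.

Local Opaque christoffel derive.

(** The source is an arbitrary normed space, so that space and time directions
    are on the same footing. *)
Section PullBack.
Context {E : normedModType R} (G : E -> 'rV[R]_n) (U : set E).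
Context (oU : open U) (sG : smooth_on U G) (UO : forall p, U p -> O (G p)).
Implicit Types (v w : E) (S X Y : E -> 'I_n -> R) (p : E).

(** Sections of the pull-back by [G] of the tangent bundle of the target are
    given by their components in the chart. *)
Definition smooth_section S := forall a, smooth_on U ((fun q => S q a) : E -> R^o).

Definition Dsec v S : E -> 'I_n -> R :=
  fun p a => 'D_v ((fun q => S q a) : E -> R^o) p.

Definition velocity v : E -> 'I_n -> R := Dsec v (fun p a => G p 0 a).

(** The connection 1-form of the pull-back, evaluated on the constant field v. *)
Definition conn_form v p a b : R :=
  \sum_c christoffel h (G p) a c b * velocity v p c.

Definition pull_nabla v S : E -> 'I_n -> R :=
  fun p a => Dsec v S p a + \sum_b conn_form v p a b * S p b.

Lemma pull_nablaE v S p a : pull_nabla v S p a = Dsec v S p a +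
  \sum_b \sum_c christoffel h (G p) a b c * velocity v p b * S p c.
Proof.
rewrite /pull_nabla exchange_big; congr (_ + _); apply: eq_bigr => b _ /=.
by rewrite /conn_form mulr_suml.
Qed.

Lemma smooth_G a : smooth_on U ((fun p => G p 0 a) : E -> R^o).
Proof. by move=> k; apply: Ck_coord. Qed.

Lemma smooth_Dsec v S : smooth_section S -> smooth_section (Dsec v S).
Proof. by move=> sS a; apply: smooth_derive. Qed.

Lemma smooth_velocity v : smooth_section (velocity v).
Proof. by apply: smooth_Dsec => a; apply: smooth_G. Qed.

Lemma smooth_comp (phi : 'rV[R]_n -> R^o) : smooth_on O phi ->
  smooth_on U ((fun p => phi (G p)) : E -> R^o).
Proof. by move=> sphi k; apply: Ck_comp UO (sphi k) (sG k). Qed.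

Lemma smooth_conn_form v a b :
  smooth_on U ((fun p => conn_form v p a b) : E -> R^o).
Proof.
apply: smooth_sum => // c; apply: smooth_mul => //.
  exact: (smooth_comp (smooth_christoffel a c b)).
exact: smooth_velocity.
Qed.

Lemma smooth_pull_nabla v S : smooth_section S ->
  smooth_section (pull_nabla v S).
Proof.
move=> sS a; apply: smooth_add => //; first exact: smooth_Dsec.
apply: smooth_sum => // b; apply: smooth_mul => //; exact: smooth_conn_form.
Qed.

Lemma smooth_inner X Y : smooth_section X -> smooth_section Y ->
  smooth_on U ((fun p => inner (h (G p)) (X p) (Y p)) : E -> R^o).
Proof.
move=> sX sY; apply: smooth_sum => // a; apply: smooth_sum => // b.
apply: smooth_mul => //; apply: smooth_mul => //.
exact: (smooth_comp (smooth_metric a b)).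
Qed.

Lemma derive_pull (phi : 'rV[R]_n -> R^o) v p : smooth_on O phi -> U p ->
  'D_v (fun q => phi (G q)) p = \sum_c pder c phi (G p) * velocity v p c.
Proof.
move=> sphi Up; rewrite derive_comp //; first exact: (sG 1).1.
exact: smooth_differentiable sphi (UO Up).
Qed.

Lemma derive_sum_smooth (I : finType) (f : I -> E -> R^o) v p :
  (forall i, smooth_on U (f i)) -> U p ->
  'D_v ((fun q => \sum_i f i q) : E -> R^o) p = \sum_i 'D_v (f i) p.
Proof.
move=> sf Up.
have E0 (r : seq I) :
    is_derive p v ((fun q => \sum_(i <- r) f i q) : E -> R^o)
      (\sum_(i <- r) 'D_v (f i) p).
  elim: r => [|i r IH].
    under eq_fun do rewrite big_nil.
    by rewrite big_nil; apply: is_derive_cst.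
  under eq_fun do rewrite big_cons.
  rewrite big_cons; apply: is_deriveD IH.
  exact/derivableP/(smooth_derivable (sf i) Up).
by have [_ E1] := E0 (index_enum I); exact: E1.
Qed.

Lemma derive_mul_smooth (f g : E -> R^o) v p :
  smooth_on U f -> smooth_on U g -> U p ->
  'D_v ((fun q => f q * g q) : E -> R^o) p = 'D_v f p * g p + f p * 'D_v g p.
Proof.
move=> sf sg Up; rewrite deriveM.
- by rewrite addrC [in LHS]/GRing.scale /= [g p * _]mulrC.
- exact: smooth_derivable sf Up.
- exact: smooth_derivable sg Up.
Qed.

Lemma derive_add_smooth (f g : E -> R^o) v p :
  smooth_on U f -> smooth_on U g -> U p ->
  'D_v ((fun q => f q + g q) : E -> R^o) p = 'D_v f p + 'D_v g p.
Proof.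
move=> sf sg Up; apply: deriveD; first exact: smooth_derivable sf Up.
exact: smooth_derivable sg Up.
Qed.

Lemma derive_metric v p a b : U p ->
  'D_v ((fun q => h (G q) a b) : E -> R^o) p =
  \sum_d (h (G p) a d * conn_form v p d b + h (G p) b d * conn_form v p d a).
Proof.
move=> Up; rewrite (derive_pull v (smooth_metric a b) Up).
under eq_bigr => c _ do rewrite (pder_metric c a b (UO Up)) mulr_suml.
rewrite exchange_big; apply: eq_bigr => d _ /=.
rewrite /conn_form !mulr_sumr -big_split; apply: eq_bigr => c _ /=.
by rewrite mulrDl !mulrA.
Qed.

(** The two terms of the derivative of the metric are absorbed by the
    connection forms acting on the two arguments. *)
Lemma inner_conn (H : 'M[R]_n) (W : 'I_n -> 'I_n -> R) (x y : 'I_n -> R) : H^T = H ->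
  inner H (fun a => \sum_b W a b * x b) y + inner H x (fun a => \sum_b W a b * y b)
  = \sum_a \sum_b (\sum_d (H a d * W d b + H b d * W d a)) * x a * y b.
Proof.
move=> sH.
have T (u v : 'I_n -> R) : inner H u (fun a => \sum_b W a b * v b)
    = \sum_a \sum_b \sum_d H a d * W d b * u a * v b.
  apply: eq_bigr => a _; rewrite exchange_big; apply: eq_bigr => d _ /=.
  rewrite mulr_sumr; apply: eq_bigr => b _.
  by rewrite mulrA [_ * u a * _]mulrAC.
rewrite innerC // !T addrC [X in _ + X]exchange_big -big_split.
apply: eq_bigr => a _; rewrite -big_split; apply: eq_bigr => b _ /=.
rewrite !mulr_suml -big_split; apply: eq_bigr => d _ /=.
by rewrite !mulrDl; congr (_ + _); rewrite mulrAC.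
Qed.

(** The Leibniz rule for the metric: its Christoffel symbols are those of the
    connection, so no term with derivatives of the metric is left. *)
Lemma derive_inner v X Y p : smooth_section X -> smooth_section Y -> U p ->
  'D_v ((fun q => inner (h (G q)) (X q) (Y q)) : E -> R^o) p =
  inner (h (G p)) (pull_nabla v X p) (Y p)
  + inner (h (G p)) (X p) (pull_nabla v Y p).
Proof.
move=> sX sY Up.
have shab a b : smooth_on U ((fun q => h (G q) a b) : E -> R^o).
  exact: (smooth_comp (smooth_metric a b)).
have sab a b : smooth_on U ((fun q => h (G q) a b * X q a) : E -> R^o).
  exact: smooth_mul.
have sabb a b : smooth_on U ((fun q => h (G q) a b * X q a * Y q b) : E -> R^o).
  exact: smooth_mul.
have sH : (h (G p))^T = h (G p) by exact/symh/UO.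
have El : inner (h (G p)) (pull_nabla v X p) (Y p) = inner (h (G p)) (Dsec v X p) (Y p)
  + inner (h (G p)) (fun a => \sum_b conn_form v p a b * X p b) (Y p) := innerDl _ _ _ _.
have Er : inner (h (G p)) (X p) (pull_nabla v Y p) = inner (h (G p)) (X p) (Dsec v Y p)
  + inner (h (G p)) (X p) (fun a => \sum_b conn_form v p a b * Y p b).
  by rewrite !(innerC (X p)) //; apply: innerDl.
rewrite El Er addrACA inner_conn //.
rewrite /inner derive_sum_smooth //; last by move=> a; apply: smooth_sum.
rewrite -!big_split; apply: eq_bigr => a _; rewrite derive_sum_smooth //.
rewrite -!big_split; apply: eq_bigr => b _ /=.
rewrite derive_mul_smooth // derive_mul_smooth // derive_metric //.
by rewrite /Dsec mulrDl [X in X + _]addrC -!addrA; congr (_ + _); rewrite addrC.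
Qed.

(** Torsion freeness: second derivatives of [G] commute, and the Christoffel
    symbols are symmetric. *)
Lemma pull_nabla_velocity v w p : U p ->
  pull_nabla v (velocity w) p = pull_nabla w (velocity v) p.
Proof.
move=> Up; apply/funext => a; rewrite pull_nablaE [RHS]pull_nablaE.
have -> : Dsec v (velocity w) p a = Dsec w (velocity v) p a.
  exact: derive_comm (smooth_G a 2) Up.
apply: (f_equal (fun z : R => Dsec w (velocity v) p a + z)).
rewrite exchange_big; apply: eq_bigr => b _; apply: eq_bigr => c _ /=.
rewrite (christoffel_sym a c b (UO Up)).
exact: mulrAC.
Qed.

Lemma Dsec_pull_nabla v w S p a : smooth_section S -> U p ->
  Dsec v (pull_nabla w S) p a = Dsec v (Dsec w S) p a
  + \sum_b ('D_v ((fun q => conn_form w q a b) : E -> R^o) p * S p b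
             + conn_form w p a b * Dsec v S p b).
Proof.
move=> sS Up; have sc b := smooth_conn_form w a b.
have sT b : smooth_on U ((fun q => conn_form w q a b * S q b) : E -> R^o).
  by apply: smooth_mul => //; apply: sc.
rewrite [LHS]derive_add_smooth //; last exact: smooth_sum.
  congr (_ + _); rewrite derive_sum_smooth //; apply: eq_bigr => b _.
  by rewrite derive_mul_smooth //; apply: sc.
exact: smooth_Dsec.
Qed.

(** The second sum is symmetric in v and w, because second derivatives of [G]
    commute; it drops out of the curvature. *)
Lemma derive_conn_form v w p a b : U p ->
  'D_v ((fun q => conn_form w q a b) : E -> R^o) p =
  \sum_c \sum_d pder c (fun z => christoffel h z a d b) (G p)
                * velocity v p c * velocity w p d
  + \sum_c christoffel h (G p) a c b * Dsec v (velocity w) p c.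
Proof.
move=> Up.
have sC c := smooth_comp (smooth_christoffel a c b).
have sT c : smooth_on U
   ((fun q => christoffel h (G q) a c b * velocity w q c) : E -> R^o).
  exact: (smooth_mul oU (sC c) (smooth_velocity w c)).
rewrite [LHS](derive_sum_smooth v sT Up) exchange_big -big_split.
apply: eq_bigr => c _; rewrite (derive_mul_smooth v (sC c) (smooth_velocity w c) Up).
rewrite (derive_pull v (smooth_christoffel a c b) Up) mulr_suml.
reflexivity.
Qed.

(** The Ricci identity.  Constant directions commute, so no bracket term
    appears. *)
Lemma pull_nabla_comm v w S p a : smooth_section S -> U p ->
  pull_nabla v (pull_nabla w S) p a = pull_nabla w (pull_nabla v S) p a
  + \sum_b \sum_c \sum_d
      riem h (G p) a b c d * S p b * velocity v p c * velocity w p d.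
Proof.
move=> sS Up.
pose D u u' b := \sum_c \sum_d pder c (fun z => christoffel h z a d b) (G p)
                * velocity u p c * velocity u' p d.
pose P u u' b := \sum_c conn_form u p a c * conn_form u' p c b.
pose T u u' b := \sum_c christoffel h (G p) a c b * Dsec u (velocity u') p c.
pose M u u' := \sum_b conn_form u' p a b * Dsec u S p b.
have X u u' : pull_nabla u (pull_nabla u' S) p a = Dsec u (Dsec u' S) p a
    + \sum_b T u u' b * S p b + (M u u' + M u' u)
    + \sum_b (D u u' b + P u u' b) * S p b.
  rewrite {1}/pull_nabla (Dsec_pull_nabla u u' a sS Up).
  under eq_bigr => b _ do rewrite (derive_conn_form u u' a b Up).
  exact: second_derivative_algebra.
have DD : Dsec v (Dsec w S) p a = Dsec w (Dsec v S) p a.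
  exact: derive_comm (sS a 2) Up.
have TT b : T v w b = T w v b.
  apply: eq_bigr => c _; apply: (f_equal (fun z : R => _ * z)).
  exact: derive_comm (smooth_G c 2) Up.
pose Rm b := \sum_c \sum_d riem h (G p) a b c d * velocity v p c * velocity w p d.
have DP b : D v w b + P v w b = D w v b + P w v b + Rm b.
  exact: (curvature_algebra (christoffel h (G p))
    (fun c a d b => pder c (fun z => christoffel h z a d b) (G p))).
have RmE : \sum_b \sum_c \sum_d
      riem h (G p) a b c d * S p b * velocity v p c * velocity w p d
    = \sum_b Rm b * S p b.
  apply: eq_bigr => b _; rewrite mulr_suml; apply: eq_bigr => c _.
  rewrite mulr_suml; apply: eq_bigr => d _.
  exact: mulr4_rot.
rewrite RmE !X DD; clearbody D P T M Rm.
under eq_bigr do rewrite TT.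
under [X in _ + X = _]eq_bigr do rewrite DP mulrDl.
by rewrite big_split [M w v + _]addrC addrA.
Qed.

Lemma pull_nabla_eq_in v X Y p : (forall q, U q -> X q = Y q) -> U p ->
  pull_nabla v X p = pull_nabla v Y p.
Proof.
move=> XY Up; apply/funext => a; rewrite /pull_nabla XY //.
apply: (f_equal (fun z : R => z + _)).
by apply: (derive_eq_in _ oU _ Up) => q; rewrite inE => Uq; rewrite XY.
Qed.

Lemma smooth_section_sumZ (I : finType) (f : I -> E -> R) (X : I -> E -> 'I_n -> R) :
  (forall i, smooth_on U (f i : E -> R^o)) -> (forall i, smooth_section (X i)) ->
  smooth_section (fun q a => \sum_i f i q * X i q a).
Proof.
move=> sf sX a; apply: smooth_sum => // i.
exact: (smooth_mul oU (sf i) (sX i a)).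
Qed.

Lemma pull_nablaB v X Y p a : smooth_section X -> smooth_section Y -> U p ->
  pull_nabla v (fun q a => X q a - Y q a) p a
  = pull_nabla v X p a - pull_nabla v Y p a.
Proof.
move=> sX sY Up; rewrite /pull_nabla.
have -> : Dsec v (fun q a => X q a - Y q a) p a = Dsec v X p a - Dsec v Y p a.
  apply: deriveB; first exact: smooth_derivable (sX a) Up.
  exact: smooth_derivable (sY a) Up.
under eq_bigr do rewrite mulrBr.
by rewrite sumrB opprD addrACA.
Qed.

Lemma pull_nabla_sumZ (I : finType) v (f : I -> E -> R) (X : I -> E -> 'I_n -> R) p a :
  (forall i, smooth_on U (f i : E -> R^o)) -> (forall i, smooth_section (X i)) ->
  U p -> pull_nabla v (fun q a => \sum_i f i q * X i q a) p a =
  \sum_i ('D_v (f i : E -> R^o) p * X i p a + f i p * pull_nabla v (X i) p a).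
Proof.
move=> sf sX Up; rewrite /pull_nabla.
have -> : Dsec v (fun q a => \sum_i f i q * X i q a) p a
    = \sum_i ('D_v (f i : E -> R^o) p * X i p a + f i p * Dsec v (X i) p a).
  have sT i : smooth_on U ((fun q => f i q * X i q a) : E -> R^o).
    exact: (smooth_mul oU (sf i) (sX i a)).
  rewrite [LHS](derive_sum_smooth v sT Up); apply: eq_bigr => i _.
  exact: derive_mul_smooth (sf i) (sX i a) Up.
move: (conn_form v p a) => W.
under [X in _ + X]eq_bigr do rewrite mulr_sumr.
rewrite exchange_big -big_split; apply: eq_bigr => i _ /=.
rewrite mulrDr mulr_sumr addrA; congr (_ + _); apply: eq_bigr => b _.
exact: mulrCA.
Qed.

Lemma pull_nabla_eq v X Y p : X p = Y p ->
  (forall a, Dsec v X p a = Dsec v Y p a) -> pull_nabla v X p = pull_nabla v Y p.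
Proof. by move=> XY D; apply/funext => a; rewrite /pull_nabla XY D. Qed.

Lemma addr_sub_swap (x y z t : R) : x + y - (z + t) = x - t + y - z.
Proof. by ring. Qed.

Lemma mulrNN_swap (x y z : R) : x * - y * - z = x * (z * y).
Proof. by ring. Qed.

Local Opaque pull_nabla inner velocity Dsec.

(** * The second fundamental form *)

(** [e] consists of the directions of the source of the immersion; the map [G]
    may depend on further parameters, such as time. *)
Section Submanifold.
Context {m : nat} (e : 'I_m -> E).

Definition frame i : E -> 'I_n -> R := velocity (e i).

Definition ind_metric p : 'M[R]_m :=
  \matrix_(i, j) inner (h (G p)) (frame i p) (frame j p).

Definition ind_christoffel p (k i j : 'I_m) : R :=
  christoffel_of (ind_metric p)
    (fun i j l => 'D_(e i) ((fun q => ind_metric q j l) : E -> R^o) p) k i j.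

Definition hess i j : E -> 'I_n -> R := pull_nabla (e i) (frame j).

Definition second_form i j : E -> 'I_n -> R :=
  fun p a => hess i j p a - \sum_k ind_christoffel p k i j * frame k p a.

Definition mean_curvature : E -> 'I_n -> R :=
  fun p a => \sum_i \sum_j invmx (ind_metric p) i j * second_form i j p a.

Context (unitg : forall p, U p -> ind_metric p \in unitmx).

Lemma smooth_frame i : smooth_section (frame i).
Proof. exact: smooth_velocity. Qed.

Lemma ind_metricE i j : (fun q => ind_metric q i j)
  = (fun q => inner (h (G q)) (frame i q) (frame j q)).
Proof. by apply/funext => q; rewrite mxE. Qed.

Lemma smooth_ind_metric i j : smooth_on U ((fun q => ind_metric q i j) : E -> R^o).
Proof.
by rewrite ind_metricE; apply: smooth_inner (smooth_frame i) (smooth_frame j).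
Qed.

Lemma smooth_inv_metric i j :
  smooth_on U ((fun q => invmx (ind_metric q) i j) : E -> R^o).
Proof. exact: (smooth_invmx oU unitg smooth_ind_metric). Qed.

Lemma ind_metric_sym p : U p -> (ind_metric p)^T = ind_metric p.
Proof.
move=> Up; apply/matrixP => i j; rewrite !mxE; apply: innerC.
exact/symh/UO.
Qed.

Lemma inv_metric_sym p i j : U p ->
  invmx (ind_metric p) i j = invmx (ind_metric p) j i.
Proof.
by move=> Up; rewrite -[in LHS](ind_metric_sym Up) -trmx_inv mxE.
Qed.

Lemma smooth_ind_christoffel k i j :
  smooth_on U ((fun q => ind_christoffel q k i j) : E -> R^o).
Proof.
have sd i' j' l := smooth_derive (e i') (smooth_ind_metric j' l).
apply: smooth_mul oU _ _; first exact: smooth_cst.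
apply: smooth_sum oU _ => l; apply: smooth_mul oU (smooth_inv_metric k l) _.
apply: smooth_add oU (smooth_add oU (sd _ _ _) (sd _ _ _)) _.
exact: smooth_opp oU (sd _ _ _).
Qed.

Lemma smooth_hess i j : smooth_section (hess i j).
Proof. exact/smooth_pull_nabla/smooth_frame. Qed.

Lemma smooth_second_form i j : smooth_section (second_form i j).
Proof.
move=> a; apply: smooth_add oU (smooth_hess i j a) (smooth_opp oU _).
apply: smooth_section_sumZ => k; first exact: smooth_ind_christoffel.
exact: smooth_frame.
Qed.

Lemma smooth_mean_curvature : smooth_section mean_curvature.
Proof.
move=> a; apply: smooth_sum oU _ => i; apply: smooth_sum oU _ => j.
exact: (smooth_mul oU (smooth_inv_metric i j) (smooth_second_form i j a)).
Qed.

Lemma hess_sym i j p : U p -> hess i j p = hess j i p.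
Proof. exact: pull_nabla_velocity. Qed.

Lemma derive_ind_metric v i j p : U p ->
  'D_v ((fun q => ind_metric q i j) : E -> R^o) p
  = inner (h (G p)) (pull_nabla v (frame i) p) (frame j p)
  + inner (h (G p)) (frame i p) (pull_nabla v (frame j) p).
Proof.
move=> Up; rewrite ind_metricE.
exact: derive_inner (smooth_frame i) (smooth_frame j) Up.
Qed.

Lemma inner_sym p (u w : 'I_n -> R) : U p -> inner (h (G p)) u w = inner (h (G p)) w u.
Proof. by move=> Up; apply/innerC/symh/UO. Qed.

(** Gauss formula.  By metric compatibility the derivatives of the induced
    metric are sums of two pairings <hess, frame>; since hess is symmetric, the
    lowered Christoffel symbol is <hess_ij, F_l>. *)
Lemma second_form_normal i j l p : U p ->
  inner (h (G p)) (second_form i j p) (frame l p) = 0.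
Proof.
move=> Up; rewrite innerBl inner_suml.
pose B i j l := inner (h (G p)) (hess i j p) (frame l p).
have dg i' j' l' : 'D_(e i') ((fun q => ind_metric q j' l') : E -> R^o) p
    = B i' j' l' + B i' l' j'.
  rewrite (derive_ind_metric _ _ _ Up).
  by rewrite [X in _ + X](inner_sym _ _ Up).
have Bsym i' j' l' : B i' j' l' = B j' i' l' by rewrite /B (hess_sym i' j' Up).
have -> : \sum_k ind_christoffel p k i j * inner (h (G p)) (frame k p) (frame l p)
    = B i j l.
  transitivity (\sum_k ind_metric p l k * ind_christoffel p k i j).
    apply: eq_bigr => k _; rewrite mxE (inner_sym _ _ Up); exact: mulrC.
  rewrite (christoffel_of_lower _ _ _ _ (unitg Up)) !dg.
  rewrite (Bsym j i l) (Bsym l i j) (Bsym l j i).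
  move: (B i j l) (B i l j) (B j l i) => x y z; by field.
by rewrite -/(B i j l) subrr.
Qed.

Lemma mean_curvature_normal l p : U p ->
  inner (h (G p)) (mean_curvature p) (frame l p) = 0.
Proof.
move=> Up; rewrite /mean_curvature.
rewrite inner_sum big1 // => i _; rewrite inner_suml big1 // => j _.
by rewrite second_form_normal ?mulr0.
Qed.

(** The derivative of the identity g^-1 g = 1. *)
Lemma derive_inv_metric v p i j : U p ->
  'D_v ((fun q => invmx (ind_metric q) i j) : E -> R^o) p =
  - \sum_k \sum_l invmx (ind_metric p) i k * invmx (ind_metric p) j l *
      'D_v ((fun q => ind_metric q k l) : E -> R^o) p.
Proof.
move=> Up; pose g := ind_metric p; pose gi := invmx g.
pose dg : 'M[R]_m := \matrix_(k, l) 'D_v ((fun q => ind_metric q k l) : E -> R^o) p.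
pose dgi : 'M[R]_m := \matrix_(k, l)
  'D_v ((fun q => invmx (ind_metric q) k l) : E -> R^o) p.
have ug : g \in unitmx by exact: unitg.
have E0 : dgi *m g + gi *m dg = 0.
  apply/matrixP => a b; rewrite mxE [RHS]mxE ![(_ *m _) _ _]mxE -big_split /=.
  have sT k : smooth_on U ((fun q => invmx (ind_metric q) a k * ind_metric q k b)
      : E -> R^o).
    exact: (smooth_mul oU (smooth_inv_metric a k) (smooth_ind_metric k b)).
  transitivity ('D_v ((fun q => \sum_k invmx (ind_metric q) a k * ind_metric q k b)
     : E -> R^o) p).
    rewrite [RHS](derive_sum_smooth v sT Up); apply: eq_bigr => k _.
    rewrite [RHS](derive_mul_smooth v (smooth_inv_metric a k)
      (smooth_ind_metric k b) Up).
    by rewrite [dgi _ _]mxE [dg _ _]mxE.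
  transitivity ('D_v (cst ((a == b)%:R : R^o) : E -> R^o) p); last exact: derive_cst.
  apply: (derive_eq_in _ oU _ Up) => q; rewrite inE => Uq.
  by have /matrixP/(_ a b) := mulVmx (unitg Uq); rewrite !mxE.
have -> : 'D_v ((fun q => invmx (ind_metric q) i j) : E -> R^o) p = dgi i j.
  by rewrite mxE.
have -> : dgi = - (gi *m dg *m gi).
  rewrite -[LHS](mulmxK ug) -/gi.
  by move/eqP: E0; rewrite addr_eq0 => /eqP ->; rewrite mulNmx.
rewrite mxE; apply: (f_equal (fun z : R => - z)).
rewrite mxE exchange_big; apply: eq_bigr => l _ /=.
rewrite mxE mulr_suml; apply: eq_bigr => k _ /=.
by rewrite [dg _ _]mxE /gi (inv_metric_sym l j Up) mulrAC.
Qed.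

(** * Evolution of the mean curvature *)

Section Evolution.
Context (tau : E) (p : E) (Up : U p).
Let vel : E -> 'I_n -> R := velocity tau.

(** Consequences of the flow equation on a single time slice: that equation may
    be differentiated in space, and says nothing about time derivatives. *)
Context (velE : vel p = mean_curvature p).
Context (DvelE : forall k, Dsec (e k) vel p = Dsec (e k) mean_curvature p).

Local Notation ip := (inner (h (G p))).
Local Notation gi := (invmx (ind_metric p)).
Local Notation A i j := (second_form i j p).

Lemma vel_normal l : ip (vel p) (frame l p) = 0.
Proof. by rewrite velE; apply: mean_curvature_normal. Qed.

Lemma smooth_vel : smooth_section vel.
Proof. exact: smooth_velocity. Qed.

(** Differentiate <H, F_l> = 0; the tangential part of hess_kl pairs to zero
    with H. *)
Lemma inner_nabla_vel_frame k l :
  ip (pull_nabla (e k) vel p) (frame l p) = - ip (A k l) (vel p).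
Proof.
have -> : pull_nabla (e k) vel p = pull_nabla (e k) mean_curvature p.
  by apply: pull_nabla_eq velE _ => a; rewrite DvelE.
have E0 : 'D_(e k) ((fun q => inner (h (G q)) (mean_curvature q) (frame l q))
    : E -> R^o) p = 0.
  transitivity ('D_(e k) (cst (0 : R^o) : E -> R^o) p); last exact: derive_cst.
  apply: (derive_eq_in _ oU _ Up) => q; rewrite inE => Uq.
  exact: mean_curvature_normal.
move: E0; rewrite (derive_inner (e k) smooth_mean_curvature (smooth_frame l) Up).
move/eqP; rewrite addr_eq0 => /eqP ->; apply: (f_equal (fun z : R => - z)).
rewrite (inner_sym _ _ Up) innerBl inner_suml velE big1 ?subr0 // => i _.
by rewrite (inner_sym _ _ Up) mean_curvature_normal ?mulr0.
Qed.

Lemma nabla_tau_frame k q : U q ->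
  pull_nabla tau (frame k) q = pull_nabla (e k) vel q.
Proof. exact: pull_nabla_velocity. Qed.

Lemma inner_second_form_sym k l : ip (A k l) (vel p) = ip (A l k) (vel p).
Proof.
have HE i j : ip (A i j) (vel p) = ip (hess i j p) (vel p).
  rewrite innerBl inner_suml big1 ?subr0 // => k' _.
  by rewrite (inner_sym (frame k' p) (vel p) Up) vel_normal mulr0.
by rewrite !HE (hess_sym k l Up).
Qed.

(** nabla_tau F_k = nabla_k H by torsion freeness. *)
Lemma derive_tau_metric k l :
  'D_tau ((fun q => ind_metric q k l) : E -> R^o) p = - (2 * ip (A k l) (vel p)).
Proof.
rewrite (derive_ind_metric _ _ _ Up) !(nabla_tau_frame _ Up).
rewrite (inner_sym (frame k p) (pull_nabla (e l) vel p) Up).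
rewrite !inner_nabla_vel_frame (inner_second_form_sym l k).
by rewrite mulr2n mulrDl mul1r opprD.
Qed.

Lemma derive_tau_inv_metric i j :
  'D_tau ((fun q => invmx (ind_metric q) i j) : E -> R^o) p
  = 2 * \sum_k \sum_l gi i k * gi j l * ip (A k l) (vel p).
Proof.
rewrite (derive_inv_metric _ _ _ Up) -sumrN mulr_sumr; apply: eq_bigr => k _.
rewrite -sumrN mulr_sumr; apply: eq_bigr => l _; rewrite derive_tau_metric.
by rewrite mulrN opprK mulrCA.
Qed.

(** Commute nabla_tau past nabla_i by the Ricci identity, then past d_j by
    torsion freeness; the tangential part of A_ij contributes the time
    derivative of its coefficients. *)
Lemma nabla_tau_second_form i j a :
  pull_nabla tau (second_form i j) p a =
  pull_nabla (e i) (pull_nabla (e j) vel) p a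
  - \sum_k ind_christoffel p k i j * pull_nabla (e k) vel p a
  + \sum_b \sum_c \sum_d
      riem h (G p) a b c d * frame j p b * vel p c * frame i p d
  - \sum_k 'D_tau ((fun q => ind_christoffel q k i j) : E -> R^o) p * frame k p a.
Proof.
have sG' k := smooth_ind_christoffel k i j.
rewrite (pull_nablaB _ _ (smooth_hess i j) _ Up); last first.
  exact: (smooth_section_sumZ sG' smooth_frame).
rewrite (pull_nabla_sumZ _ _ sG' smooth_frame Up) big_split /=.
under [X in _ - (_ + X)]eq_bigr => k _ do rewrite (nabla_tau_frame k Up).
rewrite (pull_nabla_comm tau (e i) a (smooth_frame j) Up).
have -> : pull_nabla (e i) (pull_nabla tau (frame j)) p a
    = pull_nabla (e i) (pull_nabla (e j) vel) p a.
  have Ej := pull_nabla_eq_in (e i) (nabla_tau_frame j) Up.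
  by rewrite Ej.
exact: addr_sub_swap.
Qed.

Definition rough_laplacian a : R :=
  \sum_i \sum_j gi i j * (pull_nabla (e i) (pull_nabla (e j) vel) p a
    - \sum_k ind_christoffel p k i j * pull_nabla (e k) vel p a).

Definition christoffel_drift a : R :=
  \sum_i \sum_j gi i j *
    \sum_k 'D_tau ((fun q => ind_christoffel q k i j) : E -> R^o) p * frame k p a.

Definition curvature_term a : R :=
  \sum_i \sum_j gi i j * \sum_b \sum_c \sum_d
    riem h (G p) a b c d * frame j p b * vel p c * frame i p d.

Definition second_form_up k l a : R :=
  \sum_i \sum_j gi k i * gi l j * A i j a.

(** The Leibniz rule for H = g^ij A_ij; the derivative of the inverse metric
    gives the term quadratic in A. *)
Lemma nabla_tau_mean_curvature a :
  pull_nabla tau mean_curvature p a = rough_laplacian a - christoffel_drift a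
  + curvature_term a + 2 * \sum_k \sum_l ip (A k l) (vel p) * second_form_up k l a.
Proof.
have sgi i j := smooth_inv_metric i j.
have -> : pull_nabla tau mean_curvature p a = \sum_i \sum_j
    ('D_tau ((fun q => invmx (ind_metric q) i j) : E -> R^o) p * A i j a
     + gi i j * pull_nabla tau (second_form i j) p a).
  pose Y i q a := \sum_j invmx (ind_metric q) i j * second_form i j q a.
  have sY i : smooth_section (Y i).
    exact: (smooth_section_sumZ (sgi i) (smooth_second_form i)).
  (* Unit coefficients make the outer sum an instance of the Leibniz rule. *)
  have -> : mean_curvature = (fun q a => \sum_i cst (1 : R) q * Y i q a).
    by apply/funext => q; apply/funext => b; apply: eq_bigr => i _; rewrite mul1r.
  rewrite (pull_nabla_sumZ (f := fun _ => cst 1) tau a _ sY Up); last first.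
    by move=> i; apply: smooth_cst.
  apply: eq_bigr => i _; rewrite (derive_cst (1 : R^o)) mul0r add0r /cst mul1r.
  exact: (pull_nabla_sumZ tau a (sgi i) (smooth_second_form i) Up).
under eq_bigr do rewrite big_split; rewrite big_split /= addrC.
have -> : \sum_i \sum_j
    'D_tau ((fun q => invmx (ind_metric q) i j) : E -> R^o) p * A i j a
  = 2 * \sum_k \sum_l ip (A k l) (vel p) * second_form_up k l a.
  transitivity (2 * \sum_i \sum_j \sum_k \sum_l
      ip (A k l) (vel p) * (gi k i * gi l j * A i j a)).
    rewrite mulr_sumr; apply: eq_bigr => i _; rewrite mulr_sumr.
    apply: eq_bigr => j _; rewrite derive_tau_inv_metric -mulrA mulr_suml.
    apply: (f_equal (fun z : R => 2 * z)); apply: eq_bigr => k _.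
    rewrite mulr_suml; apply: eq_bigr => l _.
    by rewrite (inv_metric_sym i k Up) (inv_metric_sym j l Up) mulrAC mulrC.
  apply: (f_equal (fun z : R => 2 * z)); rewrite sum4_exchange.
  apply: eq_bigr => k _; apply: eq_bigr => l _; rewrite mulr_sumr.
  by apply: eq_bigr => i _; rewrite mulr_sumr.
apply: (f_equal (fun z : R => z + _)).
rewrite /rough_laplacian /christoffel_drift /curvature_term.
rewrite -sumrB -big_split; apply: eq_bigr => i _ /=.
rewrite -sumrB -big_split; apply: eq_bigr => j _ /=.
by rewrite nabla_tau_second_form -mulrBr -mulrDr addrAC.
Qed.

(** * Evolution of the squared length of the mean curvature *)

Definition curvature_form : R := ip curvature_term (vel p).

Definition second_form_norm : R :=
  \sum_k \sum_l ip (second_form_up k l) (vel p) * ip (A k l) (vel p).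

(** The drift of the Christoffel symbols is tangential, hence orthogonal to the
    mean curvature. *)
Lemma derive_tau_norm :
  'D_tau ((fun q => inner (h (G q)) (mean_curvature q) (mean_curvature q))
    : E -> R^o) p
  = 2 * ip rough_laplacian (vel p) + 2 * curvature_form + 4 * second_form_norm.
Proof.
rewrite (derive_inner tau smooth_mean_curvature smooth_mean_curvature Up).
rewrite (inner_sym (mean_curvature p) _ Up) -velE.
have -> : pull_nabla tau mean_curvature p = (fun a =>
    rough_laplacian a - christoffel_drift a + curvature_term a
    + 2 * \sum_k \sum_l ip (A k l) (vel p) * second_form_up k l a).
  by apply/funext => a; exact: nabla_tau_mean_curvature.
rewrite 2!innerDl innerBl innerZl.
have -> : ip christoffel_drift (vel p) = 0.
  rewrite inner_sum big1 // => i _; rewrite inner_suml big1 // => j _.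
  rewrite inner_suml big1 ?mulr0 // => k _.
  by rewrite (inner_sym _ _ Up) vel_normal mulr0.
rewrite subr0 -/curvature_form.
have -> : ip (fun a => \sum_k \sum_l ip (A k l) (vel p) * second_form_up k l a)
    (vel p) = second_form_norm.
  rewrite inner_sum; apply: eq_bigr => k _; rewrite inner_suml; apply: eq_bigr => l _.
  exact: mulrC.
by move: (ip _ _ : R) curvature_form second_form_norm => x y z; ring.
Qed.

Definition norm_nabla : R := \sum_i \sum_j gi i j *
  ip (pull_nabla (e i) vel p) (pull_nabla (e j) vel p).

Lemma derive_vel_norm j q : U q ->
  'D_(e j) ((fun q => inner (h (G q)) (vel q) (vel q)) : E -> R^o) q
  = 2 * inner (h (G q)) (pull_nabla (e j) vel q) (vel q).
Proof.
move=> Uq; rewrite (derive_inner _ smooth_vel smooth_vel Uq).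
rewrite [X in _ + X](inner_sym _ _ Uq).
by rewrite mulr2n mulrDl mul1r.
Qed.

(** Bochner identity for the velocity field, which is H on the time slice: both
    factors of |H|^2 contribute equally, and so do the mixed terms. *)
Lemma laplacian_norm :
  \sum_i \sum_j gi i j *
    ('D_(e i) ('D_(e j) ((fun q => inner (h (G q)) (vel q) (vel q)) : E -> R^o)) p
     - \sum_k ind_christoffel p k i j *
        'D_(e k) ((fun q => inner (h (G q)) (vel q) (vel q)) : E -> R^o) p)
  = 2 * ip rough_laplacian (vel p) + 2 * norm_nabla.
Proof.
have -> : ip rough_laplacian (vel p) = \sum_i \sum_j gi i j *
   (ip (pull_nabla (e i) (pull_nabla (e j) vel) p) (vel p)
    - \sum_k ind_christoffel p k i j * ip (pull_nabla (e k) vel p) (vel p)).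
  rewrite inner_sum; apply: eq_bigr => i _; rewrite inner_suml.
  by apply: eq_bigr => j _; rewrite innerBl inner_suml.
rewrite !mulr_sumr -big_split; apply: eq_bigr => i _ /=.
rewrite !mulr_sumr -big_split; apply: eq_bigr => j _ /=.
under eq_bigr do rewrite (derive_vel_norm _ Up) mulrCA.
rewrite -mulr_sumr.
have -> : 'D_(e i) ('D_(e j) ((fun q => inner (h (G q)) (vel q) (vel q))
     : E -> R^o)) p = 2 * (ip (pull_nabla (e i) (pull_nabla (e j) vel) p) (vel p)
       + ip (pull_nabla (e i) vel p) (pull_nabla (e j) vel p)).
  have sj := smooth_inner (smooth_pull_nabla (e j) smooth_vel) smooth_vel.
  transitivity ('D_(e i) ((fun q => cst (2 : R^o) q *
      inner (h (G q)) (pull_nabla (e j) vel q) (vel q)) : E -> R^o) p).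
    apply: (derive_eq_in _ oU _ Up) => q; rewrite inE => Uq.
    exact: derive_vel_norm.
  rewrite (derive_mul_smooth _ (smooth_cst U (2 : R^o)) sj Up).
  rewrite (derive_cst (2 : R^o)) mul0r add0r /cst.
  apply: (f_equal (fun z : R => 2 * z)).
  rewrite (derive_inner _ (smooth_pull_nabla (e j) smooth_vel) smooth_vel Up).
  by rewrite (inner_sym (pull_nabla (e j) vel p) (pull_nabla (e i) vel p) Up).
move: (ip _ _ : R) (ip _ _ : R) (gi i j : R) (\sum_k _ : R) => x y z t; ring.
Qed.

Definition normal_projection (u : 'I_n -> R) a : R :=
  u a - \sum_k \sum_l gi k l * ip u (frame k p) * frame l p a.

(** Pythagoras: the pairings of nabla_i H with the frame are - <A_ij, H>, so its
    tangential part has squared norm [second_form_norm]. *)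
Lemma norm_nabla_split :
  \sum_i \sum_j gi i j * ip (normal_projection (pull_nabla (e i) vel p))
                             (normal_projection (pull_nabla (e j) vel p))
  = norm_nabla - second_form_norm.
Proof.
pose X i := pull_nabla (e i) vel p.
pose a i j := ip (A i j) (vel p).
have Xa i k : ip (X i) (frame k p) = - a i k by exact: inner_nabla_vel_frame.
have tangE (u w : 'I_n -> R) : ip (fun b => \sum_k \sum_l
    gi k l * ip u (frame k p) * frame l p b) w
  = \sum_k \sum_l gi k l * ip u (frame k p) * ip (frame l p) w.
  by rewrite inner_sum; apply: eq_bigr => k _; rewrite inner_suml.
have projE (u w : 'I_n -> R) : ip (normal_projection u) w = ip u w
    - \sum_k \sum_l gi k l * ip u (frame k p) * ip (frame l p) w.
  by rewrite innerBl tangE.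
have proj_frame (u : 'I_n -> R) k : ip (frame k p) (normal_projection u) = 0.
  rewrite (inner_sym _ _ Up) projE exchange_big /=.
  have -> : \sum_l \sum_k' gi k' l * ip u (frame k' p) * ip (frame l p) (frame k p)
     = \sum_k' (gi *m ind_metric p) k' k * ip u (frame k' p).
    rewrite exchange_big; apply: eq_bigr => k' _; rewrite mxE mulr_suml.
    by apply: eq_bigr => l _; rewrite mxE mulrAC.
  rewrite mulVmx; last exact: unitg.
  rewrite (bigD1 k) //= mxE eqxx mul1r big1 ?addr0 ?subrr // => k' /negPf kk.
  by rewrite mxE kk mul0r.
have pp i j : ip (normal_projection (X i)) (normal_projection (X j))
   = ip (X i) (X j) - \sum_k \sum_l gi k l * (a i k * a j l).
  rewrite projE big1 ?subr0; last first.
    by move=> k _; rewrite big1 // => l _; rewrite proj_frame mulr0.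
  rewrite (inner_sym (X i) (normal_projection (X j)) Up) projE.
  rewrite (inner_sym (X j) (X i) Up).
  apply: (f_equal (fun z : R => _ - z)).
  rewrite exchange_big; apply: eq_bigr => k _; apply: eq_bigr => l _ /=.
  rewrite (inner_sym (frame k p) (X i) Up) !Xa (inv_metric_sym l k Up).
  exact: mulrNN_swap.
under eq_bigr => i _ do under eq_bigr => j _ do rewrite pp mulrBr.
under eq_bigr => i _ do rewrite sumrB.
have NE : norm_nabla = \sum_i \sum_j gi i j * ip (X i) (X j) by [].
rewrite sumrB NE /second_form_norm; set N := \sum_i \sum_j gi i j * ip _ _.
apply: (f_equal (fun z : R => N - z)).
transitivity (\sum_i \sum_j \sum_k \sum_l gi i j * gi k l * (a i k * a j l)).
  apply: eq_bigr => i _; apply: eq_bigr => j _; rewrite mulr_sumr.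
  apply: eq_bigr => k _; rewrite mulr_sumr; apply: eq_bigr => l _.
  by rewrite mulrA.
apply: eq_bigr => i _; rewrite exchange_big; apply: eq_bigr => k _ /=.
have -> : ip (second_form_up i k) (vel p) = \sum_j \sum_l gi i j * gi k l * a j l.
  by rewrite inner_sum; apply: eq_bigr => j _; rewrite inner_suml.
rewrite mulr_suml; apply: eq_bigr => j _; rewrite mulr_suml.
apply: eq_bigr => l _; rewrite mulrA; exact: mulrAC.
Qed.

End Evolution.

End Submanifold.
End PullBack.
End TargetMetric.

(** * Space-time directions and time slices *)

Section SpaceTime.
Context {R : realType} {m : nat}.
Local Notation E := ('rV[R]_m * R^o)%type.

Definition space_dir (i : 'I_m) : E := (delta_mx 0 i, 0).
Definition time_dir : E := (0, 1).

Lemma pder_slice (phi : E -> R^o) i x s :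
  pder i (fun z => phi (z, s)) x = 'D_(space_dir i) phi (x, s).
Proof.
rewrite /pder /derive; set g1 := (X in lim (X @ _)); set g2 := (X in _ = lim (X @ _)).
suff -> : g1 = g2 by [].
apply/funext => r; rewrite /g1 /g2 /=.
have -> : r *: space_dir i + (x, s) = (r *: delta_mx 0 i + x, s).
  by congr pair; rewrite /= scaler0 add0r.
by [].
Qed.

Lemma open_slice (U : set E) s : open U -> open [set z | U (z, s)].
Proof.
move=> oU; have c : continuous (fun z : 'rV[R]_m => (z, s) : E).
  move=> z; apply/differentiable_continuous/differentiable_pair.
    exact: (@ex_diff _ _ _ _ _ _ _ (is_diff_id _)).
  exact: differentiable_cst.
by move/continuousP: c => /(_ U oU).
Qed.

Lemma pder_eq_slice (U : set E) (psi : 'rV[R]_m -> R) (phi : E -> R^o) i x s :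
  open U -> (forall z, U (z, s) -> psi z = phi (z, s)) -> U (x, s) ->
  pder i psi x = 'D_(space_dir i) phi (x, s).
Proof.
move=> oU E1 Ux; rewrite -pder_slice.
apply: (derive_eq_in (U := [set z | U (z, s)])); [exact: open_slice| |exact: Ux].
by move=> z; rewrite inE => Uz; apply: E1.
Qed.

(** Every time of the flow is a limit of later times of the flow, so limits
    relative to [0, T) are unique. *)
Lemma time_interval_proper (T : \bar R) t : time_interval T t ->
  ProperFilter (within (time_interval T) t^').
Proof.
move=> [t0 tT]; split; last exact: within_filter.
rewrite /within /= => H.
have : \forall s \near t, s != t -> ~ time_interval T s by exact: H.
move=> /nbhs_ballP [e /= e0]; rewrite -ball_normE /= => He.
have [s [ts st sT]] : exists s, [/\ t < s, s - t < e & (s%:E < T)%E].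
  case: T tT {H He} => [r||] //= tT.
  - rewrite lte_fin in tT.
    pose dd := Num.min e (r - t).
    have d0 : 0 < dd by rewrite lt_min e0 subr_gt0.
    have d2 : dd / 2 < dd by rewrite ltr_pdivrMr // ltr_pMr // ltr1n.
    exists (t + dd / 2); split.
    + by rewrite ltrDl divr_gt0.
    + by rewrite addrC addKr (lt_le_trans d2) // ge_min lexx.
    + rewrite lte_fin -ltrBrDl (lt_le_trans d2) //.
      by rewrite ge_min lexx orbT.
  - exists (t + e / 2); split; last exact: ltry.
    + by rewrite ltrDl divr_gt0.
    + by rewrite addrC addKr ltr_pdivrMr // ltr_pMr // ltr1n.
apply: (He s).
- by rewrite /= distrC ger0_norm // subr_ge0 ltW.
- by rewrite gt_eqF.
- by split=> //; apply: le_trans t0 (ltW ts).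
Qed.

(** The derivative relative to [0, T) is that of any smooth extension, also at
    time 0, where it is one-sided. *)
Lemma dtime_eq (T : \bar R) (U : set E) (psi : R -> R) (phi : E -> R^o) x t :
  open U -> U (x, t) -> time_interval T t ->
  (forall s, time_interval T s -> U (x, s) -> psi s = phi (x, s)) ->
  derivable phi (x, t) time_dir -> dtime T psi t = 'D_time_dir phi (x, t).
Proof.
move=> oU Ut tT E1 dphi; have PF := time_interval_proper tT.
apply: cvg_lim => //; apply/cvgrPdist_lt => e e0.
move/cvgrPdist_lt : (dphi) => /(_ e e0) Hd.
have nU : \forall s \near t, U (x, s).
  have c : continuous (fun s : R => (x, s) : E).
    move=> s; apply/differentiable_continuous/differentiable_pair.
      exact: differentiable_cst.
    exact: (@ex_diff _ _ _ _ _ _ _ (is_diff_id _)).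
  apply: (c t); exact: open_nbhs_nbhs.
have n0 : \forall h \near (0 : R), h != 0 ->
    `|'D_time_dir phi (x, t) - h^-1 *: ((phi \o shift (x, t)) (h *: time_dir)
      - phi (x, t))| < e by exact: Hd.
have n1 : \forall s \near t, s != t ->
    `|'D_time_dir phi (x, t) - (s - t)^-1 *: (phi (x, s) - phi (x, t))| < e.
  rewrite (near_shift 0) /=; apply: filterS n0 => h Hh; rewrite subr0 => ht.
  have h0 : h != 0 by apply: contra_neq ht => ->; rewrite add0r.
  have := Hh h0; rewrite addrK /=.
  have -> : h *: time_dir + (x, t) = (x, h + t).
    by congr pair; rewrite /= ?scaler0 ?add0r // /GRing.scale /= mulr1.
  by [].
rewrite /within /= near_withinE /=.
apply: filterS2 n1 nU => s n1s Us st sT.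
by rewrite (E1 s sT Us) (E1 t tT Ut); apply: n1s.
Qed.

End SpaceTime.

Lemma posdef_unitmx (R : realType) k (A : 'M[R]_k) :
  (forall v : 'rV[R]_k, v != 0 -> 0 < (v *m A *m v^T) 0 0) -> A \in unitmx.
Proof.
move=> posA; rewrite -row_free_unit -kermx_eq0; apply/rowV0P => v.
rewrite sub_kermx => /eqP vA; apply/eqP; apply: contraT => /posA.
by rewrite vA mul0mx mxE ltxx.
Qed.

(** Openness only requires continuity at the points of U, which is all that
    smoothness on U provides. *)
Lemma open_preimage_on (T T' : topologicalType) (U : set T) (O : set T')
    (f : T -> T') : open U -> open O -> (forall x, U x -> {for x, continuous f}) ->
  open (U `&` f @^-1` O).
Proof.
move=> oU oO cf; rewrite openE => x [Ux Ofx]; apply: filterI.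
  exact: open_nbhs_nbhs.
by apply: (cf x Ux); apply: open_nbhs_nbhs.
Qed.

(** * Coordinate expressions of the flow *)

Section Coordinates.
Local Opaque christoffel inner pull_nabla velocity Dsec.
Context {R : realType} {m n : nat} (h : 'rV[R]_n -> 'M[R]_n).
Local Notation E := ('rV[R]_m * R^o)%type.
(** [f] is the family of immersions in charts, [G] its extension to an open
    subset of space-time. *)
Context (f : R -> 'rV[R]_m -> 'rV[R]_n) (G : E -> 'rV[R]_n) (U : set E) (oU : open U).
Local Notation e := (@space_dir R m).

Lemma velocityE (v : E) p a :
  velocity G v p a = 'D_v ((fun q => G q 0 a) : E -> R^o) p.
Proof. by []. Qed.

Lemma DsecE (v : E) (X : E -> 'I_n -> R) p a :
  Dsec v X p a = 'D_v ((fun q => X q a) : E -> R^o) p.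
Proof. by []. Qed.

Section FixedTime.
Context (s : R) (fG : forall z, U (z, s) -> f s z = G (z, s)).

Lemma dF_frame z i : U (z, s) -> dF f s z i = frame G e i (z, s).
Proof.
move=> Uz; apply/funext => a; rewrite /frame velocityE.
by apply: (pder_eq_slice _ oU _ Uz) => y Uy; rewrite fG.
Qed.

Lemma indg_ind_metric z : U (z, s) -> indg h f s z = ind_metric h G e (z, s).
Proof.
by move=> Uz; apply/matrixP => i j; rewrite !mxE !dF_frame // fG.
Qed.

Lemma GammaM_ind_christoffel z k i j : U (z, s) ->
  GammaM h f s z k i j = ind_christoffel h G e (z, s) k i j.
Proof.
move=> Uz; rewrite /GammaM christoffelE /ind_christoffel.
rewrite (indg_ind_metric Uz).
apply: (f_equal (fun dg => christoffel_of _ dg k i j)).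
apply/funext => i'; apply/funext => j'; apply/funext => l.
by apply: (pder_eq_slice _ oU _ Uz) => y Uy; rewrite indg_ind_metric.
Qed.

Lemma nabla1_pull_nabla (V : 'rV[R]_m -> 'I_n -> R) (X : E -> 'I_n -> R) z j :
  (forall y, U (y, s) -> V y = X (y, s)) -> U (z, s) ->
  nabla1 h f s V z j = pull_nabla h G (e j) X (z, s).
Proof.
move=> VX Uz; apply/funext => a; rewrite pull_nablaE /nabla1 DsecE.
rewrite (dF_frame _ Uz) (VX z Uz) /GammaN (fG Uz).
apply: (f_equal (fun r : R => r + _)).
by apply: (pder_eq_slice _ oU _ Uz) => y Uy; rewrite VX.
Qed.

Lemma nabla1_frame z i j a : U (z, s) ->
  pder i (fun y => dF f s y j a) z
  + \sum_b \sum_c GammaN h f s z a b c * dF f s z i b * dF f s z j c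
  = hess h G e i j (z, s) a.
Proof.
move=> Uz; have E1 := @nabla1_pull_nabla (fun y => dF f s y j) (frame G e j) z i
  (fun y Uy => dF_frame j Uy) Uz.
exact: (f_equal (fun g => g a) E1).
Qed.

Lemma sff_second_form z i j : U (z, s) ->
  sff h f s z i j = second_form h G e i j (z, s).
Proof.
move=> Uz; apply/funext => a.
rewrite /sff addrAC (nabla1_frame i j a Uz) /second_form.
apply: (f_equal (fun r : R => _ - r)); apply: eq_bigr => k _.
by rewrite (GammaM_ind_christoffel k i j Uz) (dF_frame k Uz).
Qed.

Lemma meanH_mean_curvature z : U (z, s) ->
  meanH h f s z = mean_curvature h G e (z, s).
Proof.
move=> Uz; apply/funext => a; apply: eq_bigr => i _; apply: eq_bigr => j _.
by rewrite /ginv (indg_ind_metric Uz) (sff_second_form i j Uz).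
Qed.

Lemma nabla2_pull_nabla (V : 'rV[R]_m -> 'I_n -> R) (X : E -> 'I_n -> R) z i j a :
  (forall y, U (y, s) -> V y = X (y, s)) -> U (z, s) ->
  nabla2 h f s V z i j a = pull_nabla h G (e i) (pull_nabla h G (e j) X) (z, s) a
   - \sum_k ind_christoffel h G e (z, s) k i j * pull_nabla h G (e k) X (z, s) a.
Proof.
move=> VX Uz; have E1 := @nabla1_pull_nabla (fun y => nabla1 h f s V y j)
  (pull_nabla h G (e j) X) z i (fun y Uy => nabla1_pull_nabla j VX Uy) Uz.
rewrite -(f_equal (fun g => g a) E1) /nabla2 addrAC.
apply: (f_equal (fun r : R => _ - r)); apply: eq_bigr => k _.
by rewrite (GammaM_ind_christoffel k i j Uz) (nabla1_pull_nabla k VX Uz).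
Qed.

End FixedTime.

Lemma curvature_term_sum (y : 'rV[R]_n) (gi : 'M[R]_m) (F : 'I_m -> 'I_n -> R)
    (H : 'I_n -> R) a :
  \sum_i \sum_de \sum_ga \sum_ep riem h y a de ga ep * F i ep
     * (\sum_j gi i j * F j de) * H ga
  = \sum_i \sum_j gi i j * \sum_b \sum_c \sum_d
     riem h y a b c d * F j b * H c * F i d.
Proof.
apply: eq_bigr => i _.
under [RHS]eq_bigr do rewrite mulr_sumr.
rewrite [RHS]exchange_big; apply: eq_bigr => b _ /=.
under [RHS]eq_bigr do rewrite mulr_sumr.
rewrite [RHS]exchange_big; apply: eq_bigr => c _ /=.
under [RHS]eq_bigr do rewrite mulr_sumr.
rewrite [RHS]exchange_big; apply: eq_bigr => d _ /=.
rewrite mulr_sumr mulr_suml; apply: eq_bigr => j _.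
move: (riem _ _ _ _ _ _) => r; ring.
Qed.

(** The two factors of the frame exchange their roles, by the symmetry of the
    inverse metric. *)
Lemma curvature_form_sum (y : 'rV[R]_n) (gi : 'M[R]_m) (F : 'I_m -> 'I_n -> R)
    (H : 'I_n -> R) : (forall i j, gi i j = gi j i) -> (h y)^T = h y ->
  \sum_i \sum_al \sum_be \sum_ga \sum_de
    Rlow h y al be ga de * H al * F i be * H ga * (\sum_j gi i j * F j de)
  = inner (h y) (fun a => \sum_i \sum_j gi i j * \sum_b \sum_c \sum_d
     riem h y a b c d * F j b * H c * F i d) H.
Proof.
move=> sgi sh; rewrite (innerC _ _ sh) exchange_big; apply: eq_bigr => al _ /=.
transitivity (\sum_b H al * h y al b * \sum_i \sum_j gi i j *
    \sum_b0 \sum_c \sum_d riem h y b b0 c d * F j b0 * H c * F i d); last first.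
  by apply: eq_bigr => b _; rewrite [h y al b * _]mulrC.
have -> : \sum_i \sum_be \sum_ga \sum_de
    Rlow h y al be ga de * H al * F i be * H ga * (\sum_j gi i j * F j de)
  = \sum_i \sum_j gi i j * \sum_be \sum_ga \sum_de
      Rlow h y al be ga de * H al * F j be * H ga * F i de.
  rewrite [RHS]exchange_big; apply: eq_bigr => i _ /=.
  under [RHS]eq_bigr do rewrite mulr_sumr.
  rewrite [RHS]exchange_big; apply: eq_bigr => b _ /=.
  under [RHS]eq_bigr do rewrite mulr_sumr.
  rewrite [RHS]exchange_big; apply: eq_bigr => c _ /=.
  under [RHS]eq_bigr do rewrite mulr_sumr.
  rewrite [RHS]exchange_big; apply: eq_bigr => d _ /=.
  by rewrite mulr_sumr; apply: eq_bigr => j _; rewrite (sgi i j) mulrCA.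
under eq_bigr => i _ do under eq_bigr => j _ do under eq_bigr => b _ do
  under eq_bigr => c _ do under eq_bigr => d _ do rewrite Rlow_riem !mulr_suml.
under [RHS]eq_bigr => b _ do rewrite mulr_sumr.
rewrite [RHS]exchange_big; apply: eq_bigr => i _ /=.
under [RHS]eq_bigr => b _ do rewrite mulr_sumr.
rewrite [RHS]exchange_big; apply: eq_bigr => j _ /=.
under [RHS]eq_bigr => b _ do rewrite mulrCA.
rewrite -mulr_sumr; apply: (f_equal (fun r : R => _ * r)).
under [RHS]eq_bigr => b _ do rewrite mulr_sumr.
rewrite [RHS]exchange_big; apply: eq_bigr => b _ /=.
under [RHS]eq_bigr => b' _ do rewrite mulr_sumr.
rewrite [RHS]exchange_big; apply: eq_bigr => c _ /=.
under [RHS]eq_bigr => b' _ do rewrite mulr_sumr.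
rewrite [RHS]exchange_big; apply: eq_bigr => d _ /=.
apply: eq_bigr => b' _; move: (riem _ _ _ _ _ _) => r; ring.
Qed.

Section Flow.
Context (O : set 'rV[R]_n) (oO : open O) (sh : smooth_on O h).
Context (symh : forall y, O y -> (h y)^T = h y).
Context (unith : forall y, O y -> h y \in unitmx).
Context (sG : smooth_on U G) (UO : forall p, U p -> O (G p)).
Context (unitg : forall p, U p -> ind_metric h G e p \in unitmx).
Context (T : \bar R) (fG : forall s z, time_interval T s -> U (z, s) ->
  f s z = G (z, s)).
Context (t : R) (tT : time_interval T t).
Context (flow : forall z, U (z, t) ->
  meanH h f t z = velocity G (@time_dir R m) (z, t)).
Context (x : 'rV[R]_m) (Ux : U (x, t)).

Local Notation p := (x, t).
Local Notation tau := (@time_dir R m).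
Let ft z := @fG t z tT.

Lemma velocity_mean_curvature : velocity G tau p = mean_curvature h G e p.
Proof. by rewrite -(flow Ux) (meanH_mean_curvature ft Ux). Qed.

Lemma Dsec_velocity_mean_curvature k :
  Dsec (e k) (velocity G tau) p = Dsec (e k) (mean_curvature h G e) p.
Proof.
apply/funext => a; rewrite !DsecE.
transitivity (pder k (fun z => velocity G tau (z, t) a) x).
  exact/esym/pder_slice.
apply: (pder_eq_slice _ oU _ Ux) => z Uz.
by rewrite -(flow Uz) (meanH_mean_curvature ft Uz).
Qed.

Lemma mean_curvature_evolution a :
  nabla_dt_H h f T t x a =
    laplacian h f t (meanH h f t) x a
    - \sum_i \sum_j ginv h f t x i j *
        \sum_k dtGamma h f T t x k i j * dF f t x k a
    + \sum_i \sum_de \sum_ga \sum_ep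
        Rup h (f t x) a de ga ep * dF f t x i ep
          * dFup h f t x i de * meanH h f t x ga
    + 2 * \sum_k \sum_l ip h f t x (sff h f t x k l) (meanH h f t x)
                        * sffup h f t x k l a.
Proof.
have HE := flow Ux; have fE := ft Ux.
have iE := indg_ind_metric ft Ux.
have -> : nabla_dt_H h f T t x a = pull_nabla h G tau (mean_curvature h G e) p a.
  rewrite pull_nablaE /nabla_dt_H DsecE /GammaN fE HE velocity_mean_curvature.
  apply: (f_equal (fun r : R => r + _)).
  apply: (dtime_eq oU Ux tT).
    by move=> s sT Us; rewrite (meanH_mean_curvature (fun z => @fG s z sT) Us).
  exact: smooth_derivable
    (smooth_mean_curvature oO sh unith oU sG UO unitg a) Ux.
rewrite (nabla_tau_mean_curvature oO sh symh unith oU sG UO unitg Ux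
  velocity_mean_curvature Dsec_velocity_mean_curvature a).
have -> : laplacian h f t (meanH h f t) x a = rough_laplacian h G e tau p a.
  apply: eq_bigr => i _; apply: eq_bigr => j _; rewrite /ginv iE.
  by rewrite (nabla2_pull_nabla ft i j a flow Ux).
have -> : \sum_i \sum_j ginv h f t x i j *
    \sum_k dtGamma h f T t x k i j * dF f t x k a = christoffel_drift h G e tau p a.
  apply: eq_bigr => i _; apply: eq_bigr => j _; rewrite /ginv iE.
  apply: (f_equal (fun r : R => _ * r)); apply: eq_bigr => k _.
  rewrite (dF_frame ft k Ux); apply: (f_equal (fun r : R => r * _)).
  apply: (dtime_eq oU Ux tT).
    by move=> s sT Us; rewrite (GammaM_ind_christoffel (fun z => @fG s z sT) k i j Us).
  exact: smooth_derivable (smooth_ind_christoffel oO sh oU sG UO unitg k i j) Ux.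
have -> : \sum_i \sum_de \sum_ga \sum_ep
    Rup h (f t x) a de ga ep * dF f t x i ep * dFup h f t x i de * meanH h f t x ga
  = curvature_term h G e tau p a.
  rewrite /curvature_term -curvature_term_sum fE HE.
  apply: eq_bigr => i _; apply: eq_bigr => b _; apply: eq_bigr => c _.
  apply: eq_bigr => d _; rewrite (Rup_riem _ _ _ _ (unith (UO Ux))).
  rewrite (dF_frame ft i Ux) /dFup /ginv iE.
  by under eq_bigr => j _ do rewrite (dF_frame ft j Ux).
apply: (f_equal (fun r : R => _ + 2 * r)).
apply: eq_bigr => k _; apply: eq_bigr => l _.
rewrite /ip fE HE (sff_second_form ft k l Ux).
apply: (f_equal (fun r : R => _ * r)).
apply: eq_bigr => i _; apply: eq_bigr => j _.
by rewrite /ginv iE (sff_second_form ft i j Ux).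
Qed.

Let dtH2 := dtime T (fun s => normH2 h f s x) t.
Let LapH2 := laplacian0 h f t (normH2 h f t) x.
Let AH2 := \sum_i \sum_j ip h f t x (sffup h f t x i j) (meanH h f t x)
    * ip h f t x (sff h f t x i j) (meanH h f t x).
Let Rm := \sum_i \sum_al \sum_be \sum_ga \sum_de
    Rlow h (f t x) al be ga de * meanH h f t x al * dF f t x i be
      * meanH h f t x ga * dFup h f t x i de.

Lemma normH2E s z : time_interval T s -> U (z, s) -> normH2 h f s z =
  inner (h (G (z, s))) (mean_curvature h G e (z, s)) (mean_curvature h G e (z, s)).
Proof.
move=> sT Uz; rewrite /normH2 /ip (meanH_mean_curvature (fun z => @fG s z sT) Uz).
by rewrite (fG sT Uz).
Qed.

Lemma AH2_second_form_norm : AH2 = second_form_norm h G e tau p.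
Proof.
have HE := flow Ux; have fE := ft Ux; have iE := indg_ind_metric ft Ux.
apply: eq_bigr => i _; apply: eq_bigr => j _.
rewrite /ip fE HE (sff_second_form ft i j Ux); do 2!f_equal.
apply/funext => a; apply: eq_bigr => k _; apply: eq_bigr => l _.
by rewrite /ginv iE (sff_second_form ft k l Ux).
Qed.

Lemma dtime_normH2 : dtH2 =
  2 * inner (h (G p)) (rough_laplacian h G e tau p) (velocity G tau p)
  + 2 * Rm + 4 * AH2.
Proof.
have HE := flow Ux; have fE := ft Ux; have iE := indg_ind_metric ft Ux.
have smc := smooth_mean_curvature oO sh unith oU sG UO unitg.
have -> : dtH2 = 'D_tau ((fun q => inner (h (G q)) (mean_curvature h G e q)
    (mean_curvature h G e q)) : E -> R^o) p.
  apply: (dtime_eq oU Ux tT); first by move=> s sT Us; rewrite normH2E.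
  exact: smooth_derivable (smooth_inner oO sh oU sG UO smc smc) Ux.
rewrite (derive_tau_norm oO sh symh unith oU sG UO unitg Ux
  velocity_mean_curvature Dsec_velocity_mean_curvature).
have -> : Rm = curvature_form h G e tau p.
  rewrite /curvature_form /curvature_term -curvature_form_sum.
  - rewrite /Rm fE HE; do 5!(apply: eq_bigr => ? _).
    rewrite !(dF_frame ft _ Ux) /dFup /ginv iE.
    by under eq_bigr => j _ do rewrite (dF_frame ft j Ux).
  - by move=> i j; apply: (inv_metric_sym symh UO).
  - exact: symh (UO Ux).
by rewrite AH2_second_form_norm.
Qed.

Lemma laplacian0_normH2 : LapH2 =
  2 * inner (h (G p)) (rough_laplacian h G e tau p) (velocity G tau p)
  + 2 * norm_nabla h G e tau p.
Proof.
have iE := indg_ind_metric ft Ux.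
rewrite -(laplacian_norm oO sh symh unith oU sG UO e tau Ux).
pose phi : E -> R^o := fun q => inner (h (G q)) (velocity G tau q) (velocity G tau q).
have D1 k z : U (z, t) -> pder k (normH2 h f t) z = 'D_(e k) phi (z, t).
  move=> Uz; apply: (pder_eq_slice _ oU _ Uz) => y Uy.
  by rewrite /normH2 /ip (flow Uy) (ft Uy).
apply: eq_bigr => i _; apply: eq_bigr => j _; rewrite /ginv iE.
apply: (f_equal (fun r : R => _ * r)).
have -> : pder i (fun z => pder j (normH2 h f t) z) x = 'D_(e i) ('D_(e j) phi) p.
  by apply: (pder_eq_slice _ oU _ Ux) => z Uz; apply: D1.
apply: (f_equal (fun r : R => _ - r)); apply: eq_bigr => k _.
by rewrite (GammaM_ind_christoffel ft k i j Ux) (D1 k x Ux).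
Qed.

Lemma norm1form2_nabla : norm1form2 h f t x (nabla1 h f t (meanH h f t) x)
  = norm_nabla h G e tau p.
Proof.
apply: eq_bigr => i _; apply: eq_bigr => j _.
rewrite /ginv (indg_ind_metric ft Ux) /ip (ft Ux).
by rewrite !(nabla1_pull_nabla ft _ flow Ux).
Qed.

Lemma norm1form2_nablaperp : norm1form2 h f t x (nablaperp1 h f t (meanH h f t) x)
  = norm_nabla h G e tau p - AH2.
Proof.
have HE := flow Ux; have fE := ft Ux; have iE := indg_ind_metric ft Ux.
have PE i : nablaperp1 h f t (meanH h f t) x i
    = normal_projection h G e p (pull_nabla h G (e i) (velocity G tau) p).
  rewrite /nablaperp1 (nabla1_pull_nabla ft i flow Ux); apply/funext => a.
  rewrite /normal_part /normal_projection; do 2!f_equal.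
  apply: eq_bigr => k _; apply: eq_bigr => l _.
  by rewrite /ginv iE /ip fE !(dF_frame ft _ Ux).
rewrite AH2_second_form_norm.
rewrite -(norm_nabla_split oO sh symh unith oU sG UO unitg Ux
  velocity_mean_curvature Dsec_velocity_mean_curvature).
apply: eq_bigr => i _; apply: eq_bigr => j _.
by rewrite /ginv iE /ip fE !PE.
Qed.

Lemma norm_evolution :
  dtH2 = LapH2 - 2 * norm1form2 h f t x (nabla1 h f t (meanH h f t) x)
    + 4 * AH2 + 2 * Rm
  /\ dtH2 = LapH2 - 2 * norm1form2 h f t x (nablaperp1 h f t (meanH h f t) x)
    + 2 * AH2 + 2 * Rm.
Proof.
rewrite norm1form2_nabla norm1form2_nablaperp laplacian0_normH2 dtime_normH2.
move: (inner _ _ _) (norm_nabla _ _ _ _ _) AH2 Rm => a b c d.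
by split; ring.
Qed.

End Flow.
End Coordinates.

(** * Flows on manifolds *)

Lemma pullback_gram (R : realType) m n (H : 'M[R]_n) (J : 'M[R]_(m, n)) :
  \matrix_(i, j) inner H (J i) (J j) = J *m H *m J^T.
Proof.
apply/matrixP => i j; rewrite mxE [RHS]mxE /inner exchange_big.
apply: eq_bigr => b _; rewrite mxE [J^T _ _]mxE mulr_suml.
by apply: eq_bigr => a _; rewrite [J i a * _]mulrC.
Qed.

(** A positive definite form restricts to a positive definite, hence
    non-degenerate, form on the row space of J. *)
Lemma gram_unitmx (R : realType) m n (H : 'M[R]_n) (J : 'M[R]_(m, n)) :
  (forall v : 'rV[R]_n, v != 0 -> 0 < (v *m H *m v^T) 0 0) -> row_free J ->
  J *m H *m J^T \in unitmx.
Proof.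
move=> posH freeJ; apply: posdef_unitmx => v v0.
have : v *m J != 0 by rewrite mulmx_free_eq0.
by move/posH; rewrite trmx_mul !mulmxA.
Qed.

Lemma jacobian_entry (R : realType) m n (f : 'rV[R]_m -> 'rV[R]_n) x i a :
  differentiable f x -> 'J f x i a = pder i (fun z => f z 0 a) x.
Proof.
move=> df; rewrite [RHS]derive_coord // deriveEjacobian //.
by rewrite -rowE [RHS]mxE.
Qed.

Theorem corollary3p8 (R : realType) (m n : nat)
    (M : smooth_manifold R m) (orM : orientation M) (closedM : compact [set: M])
    (N : smooth_manifold R n) (g : riemannian_metric N)
    (T : \bar R) (T_gt0 : (0 < T)%E)
    (F : M -> R -> N) (solF : mcf_solution g T F)
    (c : chart R m M) (d : chart R n N) (atlas_c : atlas c) (atlas_d : atlas d)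
    (p : M) (t : R) (dom_p : cdom c p) (tT : time_interval T t)
    (dom_Fp : cdom d (F p t)) :
  let h := gcomp g d in
  let f := local_rep F c d in
  let x := cmap c p in
  let H := meanH h f t x in
  let A := sff h f t x in
  let Aup := sffup h f t x in
  let dtH2 := dtime T (fun s => normH2 h f s x) t in
  let LapH2 := laplacian0 h f t (normH2 h f t) x in
  let AH2 := \sum_i \sum_j ip h f t x (Aup i j) H * ip h f t x (A i j) H in
  let Rm := \sum_i \sum_al \sum_be \sum_ga \sum_de
    Rlow h (f t x) al be ga de * H al * dF f t x i be * H ga
      * dFup h f t x i de in
  [/\ forall al : 'I_n,
        nabla_dt_H h f T t x al =
          laplacian h f t (meanH h f t) x al
          - \sum_i \sum_j ginv h f t x i j *
              \sum_k dtGamma h f T t x k i j * dF f t x k al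
          + \sum_i \sum_de \sum_ga \sum_ep
              Rup h (f t x) al de ga ep * dF f t x i ep
                * dFup h f t x i de * H ga
          + 2 * \sum_k \sum_l ip h f t x (A k l) H * Aup k l al,
      dtH2 = LapH2 - 2 * norm1form2 h f t x (nabla1 h f t (meanH h f t) x)
             + 4 * AH2 + 2 * Rm
    & dtH2 = LapH2 - 2 * norm1form2 h f t x (nablaperp1 h f t (meanH h f t) x)
             + 2 * AH2 + 2 * Rm].
Proof.
move=> h f x.
have [U0 [G [oU0 Ux0 sG0 fG0]]] := mcf_smooth solF atlas_c atlas_d dom_p tT dom_Fp.
pose O := cimg d.
have oO : open O by exact: cimg_open.
have sh : smooth_on O h by exact: gcomp_smooth.
have symh y : O y -> (h y)^T = h y by exact: gcomp_sym.
have posh y : O y -> forall v : 'rV[R]_n, v != 0 -> 0 < (v *m h y *m v^T) 0 0.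
  by move=> Oy v v0; apply: gcomp_pos.
have unith y : O y -> h y \in unitmx by move=> Oy; apply/posdef_unitmx/posh.
have xc : cimg c x by exists p.
have xG : f t x = G (x, t) by have [] := fG0 x t Ux0 xc tT.
have OG : O (G (x, t)).
  by rewrite -xG /f /local_rep cmapK //; exists (F p t).
(* On U1 the extension G takes values in the target chart; U is the part of
   U1 where G is still an immersion at fixed time, also at negative times. *)
pose U1 : set ('rV[R]_m * R^o) :=
  (U0 `&` (fun q => q.1) @^-1` cimg c) `&` G @^-1` O.
have oc : open (cimg c) by exact: cimg_open.
have oU1 : open U1.
  refine (open_preimage_on (open_preimage_on oU0 oc _) oO _) => q.
    by move=> _; apply: cvg_fst.
  by move=> [Uq _]; apply: (sG0 0%N).
have sG1 : smooth_on U1 G.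
  by move=> k; apply: Ck_sub (sG0 k) => q [[]].
have U1O q : U1 q -> O (G q) by case.
have fG1 s z : time_interval T s -> U1 (z, s) -> f s z = G (z, s).
  by move=> sT [[Uz cz] _]; have [] := fG0 z s Uz cz sT.
have Ux1 : U1 (x, t) by split.
pose gE := ind_metric h G (@space_dir R m).
have sdet : smooth_on U1 ((fun q => \det (gE q)) : _ -> R^o).
  apply: smooth_det => // i j.
  move=> k; exact (smooth_ind_metric oO sh oU1 sG1 U1O (@space_dir R m) i j k).
pose U : set ('rV[R]_m * R^o) := U1 `&` (fun q => \det (gE q)) @^-1` [set r | r != 0].
have oU : open U.
  have on0 : open [set r : R^o | r != 0] by exact: open_neq.
  refine (open_preimage_on oU1 on0 _); exact: (sdet 0%N).
have UU1 : U `<=` U1 by move=> q [].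
have sG : smooth_on U G by move=> k; apply: Ck_sub (sG1 k).
have UO q : U q -> O (G q) by move/UU1/U1O.
have unitg q : U q -> gE q \in unitmx.
  by move=> [_ /= dq]; rewrite unitmxE unitfE.
have fG s z : time_interval T s -> U (z, s) -> f s z = G (z, s).
  by move=> sT /UU1; apply: fG1.
have dft : differentiable (f t) x.
  have nfG : \forall z \near x, G (z, t) = f t z.
    have oS : open [set z | U1 (z, t)] by exact: open_slice.
    have : nbhs x [set z | U1 (z, t)] by apply: open_nbhs_nbhs; split.
    by apply: filterS => z Uz; rewrite fG1.
  apply: near_eq_differentiable nfG _.
  apply: (@differentiable_comp _ _ _ _ (fun z : 'rV[R]_m => (z, t) : _ * R^o) G).
    apply: differentiable_pair; last exact: differentiable_cst.
    exact: (@ex_diff _ _ _ _ _ _ _ (is_diff_id _)).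
  exact: (sG1 1).1.
have Ux : U (x, t).
  split=> //=; rewrite -unitfE -unitmxE.
  have -> : gE (x, t) = 'J (f t) x *m h (G (x, t)) *m ('J (f t) x)^T.
    rewrite -pullback_gram; apply/matrixP => i j; rewrite !mxE.
    have Ji k : 'J (f t) x k = frame G (@space_dir R m) k (x, t).
      apply/funext => a; rewrite jacobian_entry //.
      rewrite -(dF_frame oU1 (fun z => @fG1 t z tT) k Ux1).
      by [].
    by rewrite !Ji.
  apply: gram_unitmx (posh _ OG) _.
  exact: mcf_immersion solF _ _ _ _ atlas_c atlas_d dom_p tT dom_Fp.
(* The equation holds at every point of the slice, hence may be differentiated
   in space. *)
have flow z : U (z, t) -> meanH h f t z = velocity G (@time_dir R m) (z, t).
  move=> Uz; have [[Uz0 cz] _] := UU1 _ Uz; have [q dq /= qz] := cz.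
  have [Fz _] := fG0 z t Uz0 cz tT.
  have zq : cinv c z = q by rewrite -qz cmapK.
  rewrite zq in Fz; apply/funext => a; rewrite velocityE.
  have mcf := mcf_equation solF atlas_c atlas_d dq tT Fz a.
  rewrite qz in mcf; apply: (etrans (esym mcf)).
  apply: (dtime_eq oU Uz tT); first by move=> s sT Us; rewrite -(fG s z sT Us).
  exact: smooth_derivable (smooth_G oU sG a) Uz.
split.
- move=> al.
  exact: (mean_curvature_evolution oU oO sh symh unith sG UO unitg fG tT flow Ux al).
- exact: (norm_evolution oU oO sh symh unith sG UO unitg fG tT flow Ux).1.
- exact: (norm_evolution oU oO sh symh unith sG UO unitg fG tT flow Ux).2.
Qed.
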